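(* Let $\mathbb K\in\{\mathbb R,\mathbb C\}$, let $B$ be a separable Banach space over $\mathbb K$ and let $X$ be a centred $B$-valued Gaussian field. Then there exist constants $\alpha,K\in(0,\infty)$ such that $$\mathbb E\exp\left(\alpha\|X\|_B^2\right)\le K.$$
   Context: A $B$-valued random field is a Borel measurable map $X$ from a probability space to $B$. It is a Gaussian field if $f(X)$ is a $\mathbb K$-valued Gaussian random variable for every $f$ in the topological dual $B'$; a complex random variable is Gaussian if its real and imaginary parts are jointly Gaussian (variance zero is allowed as degenerate Gaussian; in the complex case nonzero pseudo-variance is allowed). $X$ is centred if $\mathbb E f(X)=0$ for all $f\in B'$. *)

(* Defs.v *)
From HB Require Import structures.
From mathcomp Require Import all_boot all_order all_algebra.
From mathcomp Require Import complex.
From mathcomp Require Import all_classical all_reals all_analysis.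
Set Implicit Arguments.
Unset Strict Implicit.
Unset Printing Implicit Defensive.
Import Order.TTheory GRing.Theory Num.Theory.
Import numFieldNormedType.Exports.
Local Open Scope classical_set_scope.
Local Open Scope ring_scope.

Variant scalars := Reals | Complexes.

Definition scalar_field (R : realType) (k : scalars) : numFieldType :=
  match k with Reals => R | Complexes => R[i] end.

Definition scalar_Re (R : realType) (k : scalars) : scalar_field R k -> R :=
  match k with Reals => fun x : R => x | Complexes => @complex.Re R end.

(* In a normed module over R[i] the norm takes its values in R[i], with zero
   imaginary part, so that its real part is the usual norm. *)
Definition rnorm (R : realType) (k : scalars)
  (B : normedModType (scalar_field R k)) (x : B) : R := scalar_Re `|x|.

Definition separable (T : topologicalType) :=
  exists2 D : set T, countable D & dense D.

Definition borel_measurable d (T : measurableType d) (B : ptopologicalType)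
    (X : T -> B) :=
  measurable_fun [set: T] (X : T -> g_sigma_algebraType (@open B)).

(* For s = 0, [normal_prob m s] is the uniform law on [0, 1], hence the case
   distinction. *)
Definition gaussian_law (R : realType) (m s : R) (A : set R) : \bar R :=
  if s == 0 then \d_m A else normal_prob m s A.

Section gaussian.
Context d (T : measurableType d) (R : realType) (P : probability T R).

Definition gaussian_rv (Y : T -> R) :=
  measurable_fun [set: T] Y /\
  exists m s : R, 0 <= s /\
    forall A : set R, measurable A -> P (Y @^-1` A) = gaussian_law m s A.

Definition jointly_gaussian (Y Z : T -> R) :=
  forall a b : R, gaussian_rv (fun w => a * Y w + b * Z w).

Definition scalar_gaussian_rv (k : scalars) :
    (T -> scalar_field R k) -> Prop :=
  match k with
  | Reals => gaussian_rv
  | Complexes => fun Y : T -> R[i] =>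
      jointly_gaussian (fun w => complex.Re (Y w)) (fun w => complex.Im (Y w))
  end.

Definition zero_mean (k : scalars) : (T -> scalar_field R k) -> Prop :=
  match k with
  | Reals => fun Y : T -> R => ('E_P[Y] = 0)%E
  | Complexes => fun Y : T -> R[i] =>
      ('E_P[fun w => complex.Re (Y w)] = 0)%E /\
      ('E_P[fun w => complex.Im (Y w)] = 0)%E
  end.

Context (k : scalars) (B : normedModType (scalar_field R k)).

Definition gaussian_field (X : T -> B) :=
  borel_measurable X /\
  forall f : {linear B -> (scalar_field R k)^o}, continuous f ->
    scalar_gaussian_rv (fun w => f (X w)).

Definition centred (X : T -> B) :=
  forall f : {linear B -> (scalar_field R k)^o}, continuous f ->
    zero_mean (fun w => f (X w)).

End gaussian.

(* Main.v *)
Require Import Defs.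
From HB Require Import structures.
From mathcomp Require Import all_boot all_order all_algebra.
From mathcomp Require Import complex.
From mathcomp Require Import all_classical all_reals all_analysis.
From mathcomp Require Import measurable_realfun.
From mathcomp Require Import ring lra.
Set Implicit Arguments.
Unset Strict Implicit.
Unset Printing Implicit Defensive.
Import Order.TTheory GRing.Theory Num.Theory.
Import numFieldNormedType.Exports.
Local Open Scope classical_set_scope.
Local Open Scope ring_scope.

(** Fernique's argument.  Let X' be an independent copy of X.  If the pair
    (X, X') has the same law as ((X - X') / sqrt 2, (X + X') / sqrt 2), then
    for all s and t
      P(|X| <= s) P(|X| > t)
        = P(|X - X'| <= sqrt 2 s, |X + X'| > sqrt 2 t)
        <= P(|X| > (t - s) / sqrt 2) ^ 2,
    because on the second event both 2 |X| and 2 |X'| are at least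
    |X + X'| - |X - X'| > sqrt 2 (t - s) ([rnorm_tail_contract]).  Fix s with
    P(|X| > s) <= 1/4.  Along levels growing like sqrt 2 ^ n the tail of |X|
    is squared at each step, hence is at most 3 ^ -(2 ^ n)
    ([tail_level_le]), and summing over the shells between two consecutive
    levels gives the exponential moment ([exp_sqr_integrable]).

    The substance is the rotation invariance, of which only the values on
    events that bound two norms are used.  It is established in three steps.

    - By the Hahn-Banach theorem and separability, the norm is the supremum of
      the absolute values of countably many real parts of continuous linear
      functionals ([norming_sequence]), so that a bound on the norm is a
      countable conjunction of bounds on such functionals.

    - For real parts f, g of functionals, f(X) + g(X') is a centred Gaussian
      variable whose variance is the sum of those of f(X) and g(X')
      ([independent_sum_integral], from the convolution of Gaussian
      densities).  Its image under the rotation is F(X) + G(X') with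
      F = (f + g) / sqrt 2 and G = (g - f) / sqrt 2, and the sum of the two
      variances is the same by the parallelogram identity.  Hence both have
      the same expected cosine ([rotated_functionals_cos]).

    - Two linear families of random variables whose members have the same
      expected cosine give the same probability to every event that bounds
      countably many members in absolute value ([multiplier_indic_all]).  The
      identity cos a cos b = (cos (a + b) + cos (a - b)) / 2 makes the
      functions that may be inserted in the two expectations an algebra
      containing the cosines and closed under bounded pointwise limits;
      iterating a cubic polynomial turns cos (t u) - cos (t s) into its sign,
      and for t -> 0 this sign decides whether |u| <= s. *)

(** * The Hahn-Banach theorem *)

Section hahn_banach.
Context (R : realType) (V : lmodType R) (p : V -> R).
Hypothesis p_sub : forall x y, p (x + y) <= p x + p y.
Hypothesis p_hom : forall t x, 0 <= t -> p (t *: x) = t * p x.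

(** A partial functional below [p], encoded by its graph.  Domination alone makes
    such a set single-valued, so that unions of chains need no gluing. *)
Definition dominated_graph (G : set (V * R)) :=
  [/\ G (0, 0),
      forall t x a y b, G (x, a) -> G (y, b) -> G (t *: x + y, t * a + b) &
      forall x a, G (x, a) -> a <= p x].

Definition graph_extension (G : set (V * R)) (y : V) (c : R) : set (V * R) :=
  [set u | exists t x a, G (x, a) /\ u = (x + t *: y, a + t * c)].

(** The admissible values at [y] are those between all [a - p (x - y)] and all
    [p (x + y) - a]; sublinearity makes each of the former at most each of the
    latter, and their supremum is chosen. *)
Lemma dominated_graph_extend (G : set (V * R)) (y : V) :
  dominated_graph G -> exists c, dominated_graph (graph_extension G y c).
Proof.
move=> [G0 Glin Gp].
have Gsep x a x' b : G (x, a) -> G (x', b) -> a - p (x - y) <= p (x' + y) - b.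
  move=> Gx Gx'; have := Gp _ _ (Glin 1 _ _ _ _ Gx Gx').
  have := p_sub (x - y) (x' + y).
  rewrite scale1r mul1r addrACA (addrC (- y)) subrr addr0; lra.
pose S := [set r | exists x a, G (x, a) /\ r = a - p (x - y)].
have S_has_sup : has_sup S.
  split.
    by exists (0 - p (0 - y)), 0, 0.
  by exists (p (0 + y) - 0) => _ [x [a [Gx ->]]]; exact: Gsep.
pose c := sup S.
have c_plus x a : G (x, a) -> a + c <= p (x + y).
  move=> Gx; rewrite addrC -lerBrDr; apply: ge_sup => [|_ [x' [b [Gx' ->]]]].
    by case: S_has_sup.
  exact: Gsep.
have c_minus x a : G (x, a) -> a - c <= p (x - y).
  move=> Gx; rewrite lerBlDr addrC -lerBlDr; apply: ub_le_sup.
    by case: S_has_sup.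
  by exists x, a.
have Gscale t x a : G (x, a) -> G (t *: x, t * a).
  by move=> Gx; have := Glin t _ _ _ _ Gx G0; rewrite !addr0.
exists c; split.
- by exists 0, 0, 0; rewrite scale0r mul0r !addr0.
- move=> t _ _ _ _ [s [x [a [Gx [-> ->]]]]] [s' [x' [b [Gx' [-> ->]]]]].
  exists (t * s + s'), (t *: x + x'), (t * a + b); split; first exact: Glin.
  by rewrite scalerDr scalerDl scalerA addrACA; congr pair; ring.
- move=> _ _ [t [x [a [Gx [-> ->]]]]].
  have [t0|t0|->] := ltgtP t 0; last first.
  + by rewrite scale0r mul0r !addr0; exact: Gp.
  + have := c_plus _ _ (Gscale t^-1 _ _ Gx).
    move=> /(ler_wpM2l (ltW t0)); rewrite -(p_hom _ (ltW t0)) mulrDr scalerDr.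
    by rewrite scalerA mulrA divff ?gt_eqF// scale1r mul1r.
  + have Nt0 : 0 < - t by rewrite oppr_gt0.
    have := c_minus _ _ (Gscale (- t)^-1 _ _ Gx).
    move=> /(ler_wpM2l (ltW Nt0)); rewrite -(p_hom _ (ltW Nt0)) mulrBr scalerBr.
    rewrite scalerA mulrA divff ?gt_eqF// scale1r mul1r.
    by rewrite mulNr opprK scaleNr opprK.
Qed.

Lemma hahn_banach (x0 : V) :
  exists f : {scalar V}, (forall x, f x <= p x) /\ f x0 = p x0.
Proof.
have p0 : p 0 = 0 by rewrite -(scale0r 0) p_hom// mul0r.
pose G0 : set (V * R) := [set u | exists t, u = (t *: x0, t * p x0)].
have G0_dom : dominated_graph G0.
  split.
  - by exists 0; rewrite scale0r mul0r.
  - move=> t _ _ _ _ [a [-> ->]] [b [-> ->]]; exists (t * a + b).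
    by rewrite scalerDl scalerA; congr pair; ring.
  - move=> _ _ [t [-> ->]]; have [t0|t0] := leP 0 t; first by rewrite p_hom.
    have := p_sub (t *: x0) (- t *: x0).
    have Nt0 : 0 <= - t by rewrite oppr_ge0 ltW.
    rewrite -scalerDl subrr scale0r p0 (p_hom _ Nt0); lra.
(* The empty graph is admitted so that the empty chain has an upper bound. *)
pose P G := G = set0 \/ dominated_graph G /\ G0 `<=` G.
have [G [PG Gmax]] : exists G, P G /\ forall H, G `<` H -> ~ P H.
  apply: Zorn_bigcup => F FP Ftot.
  have [Fne|Fe] := pselect (exists H, F H /\ H <> set0); last first.
    left; rewrite -subset0 => u [H FH Hu]; apply: Fe; exists H; split=> //.
    by move=> H0; rewrite H0 in Hu.
  have dom H u : F H -> H u -> dominated_graph H.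
    by move=> FH Hu; case: (FP _ FH) => [H0|[]//]; rewrite H0 in Hu.
  right; have [H [FH Hne]] := Fne.
  case: (FP _ FH) => [//|[Hdom G0H]]; split; last first.
    by move=> u /G0H Hu; exists H.
  split.
  - by exists H => //; case: Hdom.
  - move=> t x a y b [H1 FH1 Hx] [H2 FH2 Hy].
    have [/(_ _ Hx) H2x|/(_ _ Hy) H1y] := Ftot _ _ FH1 FH2.
    + by exists H2 => //; case: (dom _ _ FH2 Hy) => _ h _; exact: h.
    + by exists H1 => //; case: (dom _ _ FH1 Hx) => _ h _; exact: h.
  - by move=> x a [H1 FH1 Hx]; case: (dom _ _ FH1 Hx) => _ _ /(_ _ _ Hx).
have [Gdom G0G] : dominated_graph G /\ G0 `<=` G.
  case: PG => // Ge; exfalso; apply: (Gmax G0); last by right; split.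
  by rewrite Ge; split=> // /(_ (0, 0)); apply; case: G0_dom.
have Gtotal y : exists c, G (y, c).
  have [c Hdom] := dominated_graph_extend y Gdom.
  have GH : G `<=` graph_extension G y c.
    by move=> [x a] Gx; exists 0, x, a; rewrite scale0r mul0r !addr0.
  have [HG|nHG] := pselect (graph_extension G y c `<=` G).
    exists c; apply: HG; exists 1, 0, 0; case: Gdom => G00 _ _.
    by rewrite scale1r mul1r !add0r.
  exfalso; apply: (Gmax (graph_extension G y c)); first by split.
  by right; split=> //; exact: subset_trans GH.
have [f Gf] := choice Gtotal.
case: Gdom => G00 Glin Gp.
have Gfun x a : G (x, a) -> a = f x.
  move=> Gx; apply/eqP; rewrite eq_le; apply/andP; split.
    by have := Gp _ _ (Glin (-1) _ _ _ _ (Gf x) Gx);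
      rewrite scaleN1r (addrC (- x)) subrr p0; lra.
  by have := Gp _ _ (Glin (-1) _ _ _ _ Gx (Gf x));
    rewrite scaleN1r (addrC (- x)) subrr p0; lra.
have f_lin : scalar f.
  by move=> t x y; apply/esym/Gfun; apply: Glin; exact: Gf.
pose fL : {scalar V} := HB.pack f (GRing.isLinear.Build _ _ _ _ f f_lin).
exists fL; split=> [x|]; first by apply: Gp; exact: Gf.
by apply/esym/Gfun/G0G; exists 1; rewrite scale1r mul1r.
Qed.

End hahn_banach.

(** * Real parts of functionals and norming families *)

Definition real_scalar (R : realType) (k : scalars) : R -> scalar_field R k :=
  match k with Reals => fun r => r | Complexes => fun r => (r%:C)%C end.

Section real_part.
Context (R : realType) (k : scalars).
Implicit Types (x y : scalar_field R k) (r : R).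

Lemma scalar_ReD x y : scalar_Re (x + y) = scalar_Re x + scalar_Re y.
Proof. by case: k x y => // -[? ?] [? ?]. Qed.

Lemma scalar_ReZ r x : scalar_Re (real_scalar k r * x) = r * scalar_Re x.
Proof. by case: k x => // -[a b] /=; rewrite mul0r subr0. Qed.

Lemma ler_scalar_Re x y : x <= y -> scalar_Re x <= scalar_Re y.
Proof. by case: k x y => // x y; rewrite lecE => /andP[]. Qed.

Lemma scalar_ReK x : 0 <= x -> real_scalar k (scalar_Re x) = x.
Proof. by case: k x => // x x0 /=; rewrite RRe_real// ger0_real. Qed.

Lemma ler_real_scalar r s : (real_scalar k r <= real_scalar k s) = (r <= s).
Proof. by case: k => //=; rewrite lecR. Qed.

Lemma ltr_real_scalar r s : (real_scalar k r < real_scalar k s) = (r < s).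
Proof. by case: k => //=; rewrite ltcR. Qed.

Lemma normr_real_scalar r : `|real_scalar k r| = real_scalar k `|r|.
Proof.
case: k => //; apply: etrans (normc_def _) _ => /=.
by rewrite expr0n addr0 sqrtr_sqr.
Qed.

Context (B : normedModType (scalar_field R k)).
Implicit Types u v : B.

Lemma rnorm_ge0 u : 0 <= rnorm u.
Proof.
have := ler_scalar_Re (normr_ge0 u); congr (_ <= _).
by case: (k).
Qed.

Lemma rnormD u v : rnorm (u + v) <= rnorm u + rnorm v.
Proof. by rewrite /rnorm -scalar_ReD; exact/ler_scalar_Re/ler_normD. Qed.

Lemma rnormB u v : rnorm (u - v) = rnorm (v - u).
Proof. by rewrite /rnorm distrC. Qed.

Lemma rnormZ r u : rnorm (real_scalar k r *: u) = `|r| * rnorm u.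
Proof. by rewrite /rnorm normrZ normr_real_scalar scalar_ReZ. Qed.

Lemma lt_rnorm u r : (`|u| < real_scalar k r) = (rnorm u < r).
Proof.
by rewrite /rnorm -{1}(scalar_ReK (normr_ge0 u)) ltr_real_scalar.
Qed.

End real_part.

(** These are all the continuous real-linear forms on [B], whichever the scalar
    field, which lets the real and complex cases be treated together. *)
Definition real_functional (R : realType) (k : scalars)
    (B : normedModType (scalar_field R k)) (g : B -> R) :=
  exists2 f : {linear B -> (scalar_field R k)^o},
    continuous f & forall x, g x = scalar_Re (f x).

Section real_functional.
Context (R : realType) (k : scalars) (B : normedModType (scalar_field R k)).
Implicit Types g h : B -> R.

Lemma real_functionalD g x y :
  real_functional g -> g (x + y) = g x + g y.
Proof. by move=> [f _ gE]; rewrite !gE linearD scalar_ReD. Qed.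

Lemma real_functionalZ g r x :
  real_functional g -> g (real_scalar k r *: x) = r * g x.
Proof. by move=> [f _ gE]; rewrite !gE linearZ scalar_ReZ. Qed.

Lemma real_functional_lin g h (a b : R) :
  real_functional g -> real_functional h ->
  real_functional (fun x => a * g x + b * h x).
Proof.
move=> [f cf gE] [f' cf' hE].
pose F := (real_scalar k a \*: f \+ real_scalar k b \*: f')%R : {linear B -> (scalar_field R k)^o}.
exists F => [x|x].
  by apply: cvgD; apply: cvgZr; [exact: cf|exact: cf'].
by rewrite gE hE /F /= scalar_ReD !scalar_ReZ.
Qed.

Lemma bounded_real_functional (f : {linear B -> (scalar_field R k)^o}) (c : R) :
  (forall x, scalar_Re `|f x| <= c * rnorm x) -> continuous f.
Proof.
move=> fc; apply: bounded_linear_continuous; apply/bounded_funP => r.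
exists (real_scalar k (`|c| * scalar_Re r)) => x xr.
rewrite -(scalar_ReK (normr_ge0 (f x))).
have : scalar_Re `|f x| <= `|c| * scalar_Re r.
  apply: le_trans (fc x) _; apply: le_trans (ler_wpM2r (rnorm_ge0 x) (ler_norm c)) _.
  by apply: ler_wpM2l => //; exact: ler_scalar_Re.
by rewrite ler_real_scalar.
Qed.

End real_functional.

Lemma norming_functional_real (R : realType) (B : normedModType R) (x0 : B) :
  exists f : {linear B -> R^o},
    [/\ continuous f, forall x, f x <= `|x| & f x0 = `|x0|].
Proof.
have [//|t x t0|f [fp fx0]] := @hahn_banach R B (fun x => `|x|) _ _ x0.
- exact: ler_normD.
- by rewrite normrZ ger0_norm.
have f_lin : linear (f : B -> R^o) by move=> t x y; rewrite linearP.
pose F : {linear B -> R^o} :=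
  HB.pack (f : B -> R^o) (GRing.isLinear.Build _ _ _ _ (f : B -> R^o) f_lin).
exists F; split=> //; apply: (@bounded_real_functional R Reals B F 1) => x.
rewrite mul1r ler_norml -[- _ <= _]lerN2 opprK; apply/andP; split; last exact: fp.
by have := fp (- x); rewrite linearN normrN.
Qed.

Section realification.
Context (R : realType).

(** An alias, so that the real module structure does not compete with the
    complex one. *)
Definition realified (V : lmodType R[i]) : Type := V.

Context (V : lmodType R[i]).

HB.instance Definition _ := GRing.Zmodule.on (realified V).

Definition real_scale (r : R) (x : realified V) : realified V :=
  ((r%:C)%C : R[i]) *: (x : V).

Lemma real_scaleA a b x : real_scale a (real_scale b x) = real_scale (a * b) x.
Proof. by rewrite /real_scale scalerA -rmorphM. Qed.

Lemma real_scale1 : left_id 1 real_scale.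
Proof. by move=> x; rewrite /real_scale rmorph1 scale1r. Qed.

Lemma real_scaleDr : right_distributive real_scale +%R.
Proof. by move=> r x y; rewrite /real_scale scalerDr. Qed.

Lemma real_scaleDl x : {morph real_scale^~ x : a b / a + b}.
Proof. by move=> a b; rewrite /real_scale rmorphD scalerDl. Qed.

HB.instance Definition _ := GRing.Zmodule_isLmodule.Build R (realified V)
  real_scaleA real_scale1 real_scaleDr real_scaleDl.

Lemma realified_scaleE (r : R) (x : V) :
  r *: (x : realified V) = ((r%:C)%C : R[i]) *: x.
Proof. by []. Qed.

End realification.

(** A real-linear form [f] is the real part of the complex-linear form
    [x |-> f x - i f (i x)]. *)
Lemma norming_functional_complex (R : realType) (B : normedModType R[i]) (x0 : B) :
  exists f : {linear B -> R[i]^o}, [/\ continuous f,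
    forall x, complex.Re (f x) <= complex.Re `|x| &
    complex.Re (f x0) = complex.Re `|x0|].
Proof.
pose p (x : realified B) := @rnorm R Complexes B x.
have [|t x t0|f [fp fx0]] := @hahn_banach R (realified B) p _ _ x0.
- by move=> x y; exact: (@rnormD R Complexes B).
- rewrite -[in RHS](ger0_norm t0); exact: (@rnormZ R Complexes B).
have fD (x y : B) : f (x + y) = f x + f y by exact: (linearD f).
have fN (x : B) : f (- x) = - f x by exact: (linearN f).
have fZ r (x : B) : f (((r%:C)%C : R[i]) *: x) = r * f x.
  by rewrite -realified_scaleE linearZ_LR.
have fC (a b : R) (x : B) :
    f ((a +i* b)%C *: x) = a * f x + b * f (('i%C : R[i]) *: x).
  rewrite (_ : (a +i* b)%C = (a%:C)%C + (b%:C)%C * 'i%C); last first.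
    by apply/eqP; rewrite eq_complex /=; apply/andP; split; apply/eqP; ring.
  by rewrite scalerDl fD fZ -scalerA fZ.
pose phi (x : B) : R[i]^o := (f x +i* - f (('i%C : R[i]) *: x))%C.
have phi_lin : linear phi.
  move=> [a b] x y; rewrite /phi scalerDr scalerA !fD (fC a b).
  rewrite (_ : 'i%C * (a +i* b)%C = ((- b) +i* a)%C :> R[i]); last first.
    by apply/eqP; rewrite eq_complex /=; apply/andP; split; apply/eqP; ring.
  rewrite (fC (- b) a); apply/eqP; rewrite eq_complex /=.
  by apply/andP; split; apply/eqP; ring.
pose F : {linear B -> R[i]^o} :=
  HB.pack phi (GRing.isLinear.Build _ _ _ _ phi phi_lin).
have f_abs (x : B) : `|f x| <= @rnorm R Complexes B x.
  rewrite ler_norml -[- _ <= _]lerN2 opprK; apply/andP; split; last exact: fp.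
  have -> : @rnorm R Complexes B x = @rnorm R Complexes B (- x).
    by rewrite /rnorm normrN.
  by have := fp (- x); rewrite fN.
exists F; split=> [|x|]; [|exact: fp|exact: fx0].
apply: (@bounded_real_functional R Complexes B F 2) => x.
apply: (@le_trans _ _ (`|f x| + `|f (('i%C : R[i]) *: x)|)).
  have -> : @scalar_Re R Complexes `|F x| = _ := congr1 (@complex.Re R) (normc_def (phi x)).
  rewrite /= -[leRHS]ger0_norm ?addr_ge0// -sqrtr_sqr ler_wsqrtr//.
  rewrite sqrrD !real_normK ?num_real// sqrrN -addrA lerD2l lerDr.
  by rewrite mulrn_wge0// mulr_ge0.
rewrite mulr_natl mulr2n lerD//; apply: le_trans (f_abs _) _.
rewrite /rnorm normrZ.
have -> : `|'i%C : R[i]| = 1 by rewrite normc_def /= expr0n expr1n add0r sqrtr1.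
by rewrite mul1r.
Qed.

Lemma norming_functional (R : realType) (k : scalars)
    (B : normedModType (scalar_field R k)) (x0 : B) :
  exists g, [/\ real_functional g, forall x : B, g x <= rnorm x &
    g x0 = rnorm x0].
Proof.
case: k B x0 => B x0.
- have [f [cf fle fx0]] := @norming_functional_real R B x0.
  by exists f; split=> //; exists f.
- have [f [cf fle fx0]] := @norming_functional_complex R B x0.
  by exists (fun x => complex.Re (f x)); split=> //; exists f.
Qed.

(** Functionals norming the points of a dense sequence suffice: if [|x - z| < e]
    and [g] norms [z], then [g x > |x| - 2 e]. *)
Lemma norming_sequence (R : realType) (k : scalars)
    (B : normedModType (scalar_field R k)) : separable B ->
  exists g : nat -> B -> R, (forall n, real_functional (g n)) /\
    forall x s, rnorm x <= s <-> forall n, `|g n x| <= s.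
Proof.
move=> [D cD dD].
have D_approx (x : B) (e : R) : 0 < e -> exists2 y, D y & rnorm (x - y) < e.
  move=> e0; pose O := (ball x (real_scalar k e))^°.
  have Ox : O x.
    apply: nbhsx_ballx; move: e0; rewrite -(ltr_real_scalar k).
    by rewrite (_ : real_scalar k 0 = 0)//; case: (k).
  have [y [Oy Dy]] := dD O (ex_intro _ x Ox) (@open_interior _ _).
  exists y => //; have := interior_subset Oy.
  by rewrite -ball_normE /= lt_rnorm.
have /countable_injP[i i_inj] := cD.
have [y yP] : exists y : nat -> B,
    forall n z, D z -> i z = n -> y n = z.
  suff /choice : forall n, exists y, forall z, D z -> i z = n -> y = z.
    by move=> [y yP]; exists y.
  move=> n.
  have [[y [Dy iy]]|no] := pselect (exists y, D y /\ i y = n).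
    exists y => z Dz iz; apply: i_inj; rewrite ?inE// iy; exact/esym.
  by exists 0 => z Dz iz; exfalso; apply: no; exists z.
have [g gP] := choice (fun n => norming_functional (y n)).
exists g; split=> [n|x s]; first by case: (gP n).
have g_abs n z : `|g n z| <= rnorm z.
  have [rg gle _] := gP n.
  rewrite ler_norml gle andbT -[- _ <= _]lerN2 opprK.
  have := gle (real_scalar k (-1) *: z).
  by rewrite (real_functionalZ _ _ rg) rnormZ normrN normr1 mulN1r mul1r.
split=> [xs n|gs]; first exact: le_trans (g_abs n x) xs.
rewrite leNgt; apply/negP => sx.
pose e := (rnorm x - s) / 2.
have e0 : 0 < e by rewrite divr_gt0// subr_gt0.
have [z Dz xz] := D_approx x e e0.
have [rg _ gz] := gP (i z).
have yz : y (i z) = z by exact: yP.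
rewrite yz in gz.
have := gs (i z); have := g_abs (i z) (x - z); have := rnormD (x - z) z.
have := real_functionalD (x - z) z rg.
rewrite subrK gz => gxE triangle.
rewrite !ler_norml => /andP[dist _] /andP[_]; rewrite gxE.
by move: dist triangle xz sx; rewrite /e; lra.
Qed.

(** * Bounded limits of trigonometric polynomials *)

Section sign_iteration.
Context (R : realType).
Implicit Types v : R.

(** An odd cubic whose fixed points are -1, 0 and 1; on [[-1, 1]] the origin is
    repelling and the other two are attracting, so its iterates tend to the
    sign function. *)
Definition smoothstep v := (3 * v - v ^+ 3) / 2.

Lemma smoothstep_norm_le1 v : `|v| <= 1 -> `|smoothstep v| <= 1.
Proof.
rewrite !ler_norml /smoothstep => /andP[v0 v1]; rewrite !exprS expr0 mulr1.
have := mulr_ge0 (sqr_ge0 (1 - v)) (_ : 0 <= 2 + v).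
have := mulr_ge0 (sqr_ge0 (1 + v)) (_ : 0 <= 2 - v).
rewrite !expr2; nra.
Qed.

Lemma iter_smoothstep_norm_le1 n v : `|v| <= 1 -> `|iter n smoothstep v| <= 1.
Proof. by move=> v1; elim: n => //= n; exact: smoothstep_norm_le1. Qed.

Lemma iter_smoothstepN n v : iter n smoothstep (- v) = - iter n smoothstep v.
Proof. by elim: n => //= n ->; rewrite /smoothstep; field. Qed.

(** For [0 < v <= w <= 1] the distance from [w] to 1 is multiplied by
    [1 - w (1 + w) / 2 <= 1 - v (1 + v) / 2 < 1]. *)
Lemma iter_smoothstep_cvg v : `|v| <= 1 ->
  iter n smoothstep v @[n --> \oo] --> Num.sg v.
Proof.
wlog v0 : v / 0 <= v => [hwlog v1|v1].
  have [v0|v0] := leP 0 v; first exact: hwlog.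
  rewrite -(opprK v) sgrN; under eq_fun do rewrite iter_smoothstepN.
  by apply: cvgN; apply: hwlog; rewrite ?normrN// oppr_ge0 ltW.
have [->|vN0] := eqVneq v 0.
  rewrite sgr0 (_ : (fun n => _) = cst 0); first exact: cvg_cst.
  by apply/funext; elim=> //= n ->; rewrite /smoothstep; field.
have {}v0 : 0 < v by rewrite lt_neqAle eq_sym vN0.
rewrite gtr0_sg//; pose r := 1 - v * (1 + v) / 2.
rewrite (ger0_norm (ltW v0)) in v1.
have H n : v <= iter n smoothstep v <= 1 /\ 1 - iter n smoothstep v <= r ^+ n.
  elim: n => [|n] /=; first by rewrite expr0; split; [apply/andP; split|]; lra.
  set w := iter n _ _ => -[/andP[vw w1] wr].
  have step : 1 - smoothstep w <= r * (1 - w).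
    have -> : 1 - smoothstep w = (1 - w * (1 + w) / 2) * (1 - w).
      by rewrite /smoothstep; field.
    by apply: ler_wpM2r; rewrite /r; nra.
  have le_step : w <= smoothstep w.
    rewrite -subr_ge0 (_ : _ - w = w * (1 - w) * (1 + w) / 2).
      by rewrite divr_ge0// !mulr_ge0//; lra.
    by rewrite /smoothstep; field.
  have /ler_normlP[_ ?] : `|smoothstep w| <= 1.
    by apply: smoothstep_norm_le1; rewrite ger0_norm//; lra.
  split; first by apply/andP; split; lra.
  rewrite exprS; apply: le_trans step _; apply: ler_wpM2l => //.
  rewrite /r; nra.
apply/cvgrPdist_le => e e0.
have r_lt1 : `|r| < 1 by rewrite ltr_norml /r; nra.
have /cvgrPdist_le/(_ e e0) := cvg_expr r_lt1.
apply: filterS => n; rewrite sub0r normrN => rn.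
have [/andP[_ n1] nr] := H n.
by rewrite ger0_norm ?subr_ge0//; apply: le_trans nr _; apply: le_trans (ler_norm _) rn.
Qed.

(** The cosine decreases on [[0, pi]], an interval that contains [|u| / n] and
    [s / n] for large [n]. *)
Lemma ler_cos_small (u s : R) : 0 <= s ->
  \forall n \near \oo, (cos (n.+1%:R^-1 * s) <= cos (n.+1%:R^-1 * u)) = (`|u| <= s).
Proof.
move=> s0; pose M := (`|u| + s) / pi.
have M0 : 0 <= M by rewrite divr_ge0 ?pi_ge0// addr_ge0.
exists (Num.trunc M) => // n /= Mn.
have n0 : 0 < n.+1%:R^-1 :> R by rewrite invr_gt0.
have small x : 0 <= x <= `|u| + s -> n.+1%:R^-1 * x \in `[0, pi].
  move=> /andP[x0 xM]; rewrite in_itv /= mulr_ge0 ?(ltW n0)//=.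
  rewrite ler_pdivrMl// mulrC -ler_pdivrMl ?pi_gt0// mulrC.
  apply: (@le_trans _ _ M); first by rewrite ler_pM2r ?invr_gt0 ?pi_gt0.
  have /andP[_ /ltW Mt] := truncn_itv M0.
  by apply: le_trans Mt _; rewrite ler_nat.
rewrite -(cos_norm (_ * u)) normrM (gtr0_norm n0).
rewrite !leNgt ltr_cos ?ltr_pM2l//; apply: small; apply/andP; split;
  by rewrite ?lerDl ?lerDr ?normr_ge0.
Qed.

End sign_iteration.

Section bounded_measurable.
Context d (T : measurableType d) (R : realType) (P : probability T R).
Implicit Types F G : T -> R.

Definition bounded_measurable F :=
  measurable_fun setT F /\ exists M, forall x, `|F x| <= M.

Lemma bounded_measurable_cst c : bounded_measurable (cst c).
Proof. by split; [exact: measurable_cst|exists `|c|]. Qed.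

Lemma bounded_measurableD F G : bounded_measurable F -> bounded_measurable G ->
  bounded_measurable (fun x => F x + G x).
Proof.
move=> [mF [M FM]] [mG [N GN]]; split; first exact: measurable_funD.
by exists (M + N) => x; apply: le_trans (ler_normD _ _) _; exact: lerD.
Qed.

Lemma bounded_measurableM F G : bounded_measurable F -> bounded_measurable G ->
  bounded_measurable (fun x => F x * G x).
Proof.
move=> [mF [M FM]] [mG [N GN]]; split; first exact: measurable_funM.
by exists (M * N) => x; rewrite normrM; exact: ler_pM.
Qed.

Lemma bounded_measurable_cos F : measurable_fun setT F ->
  bounded_measurable (fun x => cos (F x)).
Proof.
move=> mF; split; last by exists 1 => x; exact: cos_max.
by apply: measurableT_comp mF; apply: continuous_measurable_fun; exact: continuous_cos.
Qed.

Lemma bounded_measurable_integrable F : bounded_measurable F ->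
  P.-integrable setT (EFin \o F).
Proof.
move=> [mF [M FM]]; apply: measurable_bounded_integrable => //.
  exact: fin_num_fun_lty.
exists M; split; first exact: num_real.
by move=> N /ltW MN x _ /=; exact: le_trans (FM x) MN.
Qed.

Lemma bounded_measurable_cvg (F_ : nat -> T -> R) F (M : R) :
  (forall n, bounded_measurable (F_ n)) -> (forall n x, `|F_ n x| <= M) ->
  (forall x, F_ n x @[n --> \oo] --> F x) -> bounded_measurable F.
Proof.
move=> bF F_M F_F; split.
  by apply: (@measurable_fun_cvg _ _ _ _ F_) => // n; case: (bF n).
exists M => x; have Fx : `|F_ n x| @[n --> \oo] --> `|F x| by apply: cvg_norm.
rewrite -(cvg_lim _ Fx)//; apply: limr_le; first by apply/cvg_ex; exists `|F x|.
exact: nearW.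
Qed.

Lemma bounded_Rintegral_cvg (F_ : nat -> T -> R) F (M : R) :
  (forall n, bounded_measurable (F_ n)) -> (forall n x, `|F_ n x| <= M) ->
  (forall x, F_ n x @[n --> \oo] --> F x) ->
  \int[P]_x F_ n x @[n --> \oo] --> \int[P]_x F x.
Proof.
move=> bF F_M F_F; have bFlim := bounded_measurable_cvg bF F_M F_F.
apply: fine_cvg; rewrite fineK; last first.
  by apply: integrable_fin_num => //; exact: bounded_measurable_integrable.
apply: (@dominated_cvg _ _ _ P setT measurableT _ _ (cst M%:E)) => //.
- by move=> n; apply/measurable_EFinP; case: (bF n).
- by move=> x _; apply: cvg_EFin; [exact: nearW|exact: F_F].
- exact: (bounded_measurable_integrable (bounded_measurable_cst M)).
- by move=> n x _ /=; rewrite lee_fin.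
Qed.

End bounded_measurable.

Section cosine_transform.
Context d1 (T1 : measurableType d1) d2 (T2 : measurableType d2) (R : realType).
Context (P1 : probability T1 R) (P2 : probability T2 R).
Context (L : set ((T1 -> R) * (T2 -> R))).
Hypothesis L_meas : forall u v, L (u, v) ->
  measurable_fun setT u /\ measurable_fun setT v.
Hypothesis L_lin : forall u v u' v' (a b : R), L (u, v) -> L (u', v') ->
  L (fun x => a * u x + b * u' x, fun y => a * v y + b * v' y).
Hypothesis L_cos : forall u v, L (u, v) ->
  \int[P1]_x cos (u x) = \int[P2]_y cos (v y).

(** The pairs in [L] are corresponding members of two linear families of random
    variables, living on possibly different spaces. *)
Definition cos_agree (F : T1 -> R) (G : T2 -> R) := forall u v, L (u, v) ->
  \int[P1]_x (F x * cos (u x)) = \int[P2]_y (G y * cos (v y)).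

(** Agreement is preserved by sums but not by products; the pairs whose
    insertion preserves it form an algebra closed under bounded limits. *)
Definition multiplier (g : T1 -> R) (h : T2 -> R) :=
  [/\ bounded_measurable g, bounded_measurable h &
      forall F G, bounded_measurable F -> bounded_measurable G ->
      cos_agree F G ->
      cos_agree (fun x => F x * g x) (fun y => G y * h y)].

Lemma multiplier_cst c : multiplier (cst c) (cst c).
Proof.
split; [exact: bounded_measurable_cst|exact: bounded_measurable_cst|].
move=> F G bF bG FG u v Luv; have [mu mv] := L_meas Luv.
under eq_Rintegral do rewrite /= mulrAC.
under [RHS]eq_Rintegral do rewrite /= mulrAC.
rewrite !RintegralZr// ?(FG _ _ Luv)//; apply: bounded_measurable_integrable;
  by apply: bounded_measurableM => //; exact: bounded_measurable_cos.
Qed.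

Lemma multiplierD g h g' h' : multiplier g h -> multiplier g' h' ->
  multiplier (fun x => g x + g' x) (fun y => h y + h' y).
Proof.
move=> [bg bh gh] [bg' bh' gh'].
split; [exact: bounded_measurableD|exact: bounded_measurableD|].
move=> F G bF bG FG u v Luv; have [mu mv] := L_meas Luv.
under eq_Rintegral do rewrite mulrDr mulrDl.
under [RHS]eq_Rintegral do rewrite mulrDr mulrDl.
have int d (T : measurableType d) (P : probability T R) (H w r : T -> R) :
    bounded_measurable H -> bounded_measurable w -> measurable_fun setT r ->
    P.-integrable setT (EFin \o (fun x => H x * w x * cos (r x))).
  move=> bH bw mr; apply: bounded_measurable_integrable.
  apply: bounded_measurableM; first exact: bounded_measurableM.
  exact: bounded_measurable_cos.
rewrite (RintegralD _ (int _ _ P1 _ _ _ bF bg mu) (int _ _ P1 _ _ _ bF bg' mu))//.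
rewrite (RintegralD _ (int _ _ P2 _ _ _ bG bh mv) (int _ _ P2 _ _ _ bG bh' mv))//.
by rewrite (gh _ _ bF bG FG _ _ Luv) (gh' _ _ bF bG FG _ _ Luv).
Qed.

Lemma multiplierM g h g' h' : multiplier g h -> multiplier g' h' ->
  multiplier (fun x => g x * g' x) (fun y => h y * h' y).
Proof.
move=> [bg bh gh] [bg' bh' gh'].
split; [exact: bounded_measurableM|exact: bounded_measurableM|].
move=> F G bF bG FG u v Luv.
under eq_Rintegral do rewrite mulrA.
under [RHS]eq_Rintegral do rewrite mulrA.
apply: gh' => //; [exact: bounded_measurableM|exact: bounded_measurableM|].
exact: gh.
Qed.

Lemma multiplier_cvg (g_ : nat -> T1 -> R) (h_ : nat -> T2 -> R) g h (M : R) :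
  (forall n, multiplier (g_ n) (h_ n)) ->
  (forall n x, `|g_ n x| <= M) -> (forall n y, `|h_ n y| <= M) ->
  (forall x, g_ n x @[n --> \oo] --> g x) ->
  (forall y, h_ n y @[n --> \oo] --> h y) -> multiplier g h.
Proof.
move=> gh_ g_M h_M g_g h_h.
have bg n : bounded_measurable (g_ n) by case: (gh_ n).
have bh n : bounded_measurable (h_ n) by case: (gh_ n).
split; [exact: bounded_measurable_cvg g_g|exact: bounded_measurable_cvg h_h|].
move=> F G bF bG FG u v Luv; have [mu mv] := L_meas Luv.
have bcu := bounded_measurable_cos mu; have bcv := bounded_measurable_cos mv.
have [[_ [N FN]] [_ [N' GN]]] := (bF, bG).
have lim1 : \int[P1]_x (F x * g_ n x * cos (u x)) @[n --> \oo] -->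
    \int[P1]_x (F x * g x * cos (u x)).
  apply: (@bounded_Rintegral_cvg _ _ _ _ _ _ (N * M * 1)).
  - by move=> n; do 2 apply: bounded_measurableM => //.
  - by move=> n x; rewrite !normrM !ler_pM ?mulr_ge0// cos_max.
  - by move=> x; apply: cvgM; [apply: cvgM|]; [exact: cvg_cst| |exact: cvg_cst].
have lim2 : \int[P2]_y (G y * h_ n y * cos (v y)) @[n --> \oo] -->
    \int[P2]_y (G y * h y * cos (v y)).
  apply: (@bounded_Rintegral_cvg _ _ _ _ _ _ (N' * M * 1)).
  - by move=> n; do 2 apply: bounded_measurableM => //.
  - by move=> n x; rewrite !normrM !ler_pM ?mulr_ge0// cos_max.
  - by move=> x; apply: cvgM; [apply: cvgM|]; [exact: cvg_cst| |exact: cvg_cst].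
have agree n : \int[P1]_x (F x * g_ n x * cos (u x)) =
    \int[P2]_y (G y * h_ n y * cos (v y)).
  by case: (gh_ n) => _ _; apply.
rewrite (_ : (fun n => _) = fun n => \int[P2]_y (G y * h_ n y * cos (v y))) in lim1.
  exact: (cvg_unique _ lim1 lim2).
by apply/funext.
Qed.

(** Multiplying by a cosine replaces each test variable by its sum and its
    difference with the new one, and [L] is stable under both. *)
Lemma multiplier_cos u v : L (u, v) ->
  multiplier (fun x => cos (u x)) (fun y => cos (v y)).
Proof.
move=> Luv; have [mu mv] := L_meas Luv.
split; [exact: bounded_measurable_cos|exact: bounded_measurable_cos|].
move=> F G bF bG FG u' v' Luv'; have [mu' mv'] := L_meas Luv'.
have cosM (a b c : R) : a * cos b * cos c =
    2^-1 * (a * cos (1 * b + 1 * c)) + 2^-1 * (a * cos (1 * b + -1 * c)).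
  by rewrite !mul1r mulN1r cosD cosB; field.
have Lp := L_lin 1 1 Luv Luv'; have Lm := L_lin 1 (-1) Luv Luv'.
have [mup mvp] := L_meas Lp; have [mum mvm] := L_meas Lm.
under eq_Rintegral do rewrite cosM.
under [RHS]eq_Rintegral do rewrite cosM.
have half d (T : measurableType d) (P : probability T R) (H w w' : T -> R) :
    bounded_measurable H -> measurable_fun setT w -> measurable_fun setT w' ->
    \int[P]_x (2^-1 * (H x * cos (w x)) + 2^-1 * (H x * cos (w' x))) =
    2^-1 * \int[P]_x (H x * cos (w x)) + 2^-1 * \int[P]_x (H x * cos (w' x)).
  move=> bH mw mw'.
  have bHw := bounded_measurableM bH (bounded_measurable_cos mw).
  have bHw' := bounded_measurableM bH (bounded_measurable_cos mw').
  rewrite RintegralD ?RintegralZl//; try exact: bounded_measurable_integrable.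
    by apply: bounded_measurable_integrable; apply: bounded_measurableM => //;
      exact: bounded_measurable_cst.
  by apply: bounded_measurable_integrable; apply: bounded_measurableM => //;
    exact: bounded_measurable_cst.
rewrite (half _ _ P1 F _ _ bF mup mum) (half _ _ P2 G _ _ bG mvp mvm).
by rewrite (FG _ _ Lp) (FG _ _ Lm).
Qed.

Lemma multiplier_sg g h : multiplier g h ->
  (forall x, `|g x| <= 1) -> (forall y, `|h y| <= 1) ->
  multiplier (fun x => Num.sg (g x)) (fun y => Num.sg (h y)).
Proof.
move=> gh g1 h1.
apply: (@multiplier_cvg (fun n x => iter n (@smoothstep R) (g x))
  (fun n y => iter n (@smoothstep R) (h y)) _ _ 1).
- elim=> [//|n IHn] /=; rewrite /smoothstep.
  apply: multiplierM; last exact: (multiplier_cst 2^-1).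
  apply: multiplierD; first by apply: multiplierM; first exact: multiplier_cst.
  under eq_fun do rewrite -mulN1r.
  under [X in multiplier _ X]eq_fun do rewrite -mulN1r.
  apply: multiplierM; first exact: multiplier_cst.
  by do 2 apply: multiplierM => //.
- by move=> n x; exact: iter_smoothstep_norm_le1.
- by move=> n y; exact: iter_smoothstep_norm_le1.
- by move=> x; exact: iter_smoothstep_cvg.
- by move=> y; exact: iter_smoothstep_cvg.
Qed.

Lemma multiplier_ge0 g h : multiplier g h ->
  (forall x, `|g x| <= 1) -> (forall y, `|h y| <= 1) ->
  multiplier (fun x => (0 <= g x)%R%:R) (fun y => (0 <= h y)%R%:R).
Proof.
move=> gh g1 h1; have sgh := multiplier_sg gh g1 h1.
have ind (t : R) : (0 <= t)%R%:R =
    1 + (2^-1 * Num.sg t + (- 2^-1) * (Num.sg t * Num.sg t)).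
  by case: sgrP => _ /=; field.
under eq_fun do rewrite ind; under [X in multiplier _ X]eq_fun do rewrite ind.
apply: multiplierD; first exact: multiplier_cst.
apply: multiplierD; first by apply: multiplierM => //; exact: multiplier_cst.
by apply: multiplierM; [exact: multiplier_cst|exact: multiplierM].
Qed.

(** The event [|u| <= s] is the limit, as [t] decreases to 0, of the events
    [cos (t u) >= cos (t s)], whose indicators come from the sign of a
    trigonometric polynomial. *)
Lemma multiplier_indic u v (s : R) : L (u, v) ->
  multiplier (fun x => (`|u x| <= s)%R%:R) (fun y => (`|v y| <= s)%R%:R).
Proof.
move=> Luv; have [s0|s0] := ltP s 0.
  have lt0 (t : R) : (`|t| <= s) = false.
    by apply/negbTE; rewrite -ltNge (lt_le_trans s0).
  under eq_fun do rewrite lt0; under [X in multiplier _ X]eq_fun do rewrite lt0.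
  exact: (multiplier_cst 0).
pose w n (t : R) := (cos (n.+1%:R^-1 * t) - cos (n.+1%:R^-1 * s)) / 2.
have w1 n t : `|w n t| <= 1.
  rewrite normrM normfV normr_nat ler_pdivrMr// mul1r.
  by apply: le_trans (ler_normB _ _) _; rewrite mulr2n lerD// cos_max.
have w_cvg t :
    ((0 <= w n t)%R%:R : R) @[n --> \oo] --> ((`|t| <= s)%R%:R : R).
  apply: cvg_near_cst; apply: filterS (ler_cos_small t s0) => n <-.
  by rewrite /w pmulr_lge0 ?invr_gt0// subr_ge0.
apply: (@multiplier_cvg (fun n x => (0 <= w n (u x))%R%:R)
  (fun n y => (0 <= w n (v y))%R%:R) _ _ 1) => //.
- move=> n; apply: multiplier_ge0 => //.
  apply: multiplierM; last exact: (multiplier_cst 2^-1).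
  apply: multiplierD; last exact: (multiplier_cst (- cos _)).
  have := multiplier_cos (L_lin n.+1%:R^-1 0 Luv Luv).
  under eq_fun do rewrite mul0r addr0.
  by under [X in multiplier _ X -> _]eq_fun do rewrite mul0r addr0.
- by move=> n x; rewrite normr_nat lern1 leq_b1.
- by move=> n y; rewrite normr_nat lern1 leq_b1.
Qed.

Lemma multiplier_indic_all (u : nat -> T1 -> R) (v : nat -> T2 -> R) (s : R) :
  (forall i, L (u i, v i)) ->
  multiplier (fun x => `[< forall i, `|u i x| <= s >]%:R)
             (fun y => `[< forall i, `|v i y| <= s >]%:R).
Proof.
move=> Luv.
have prod_cvg (b : nat -> bool) :
    (\prod_(i < n) (b i)%:R : R) @[n --> \oo] -->
    (`[< forall i, b i >]%:R : R).
  apply: cvg_near_cst; case: asboolP => [ball|/existsNP[i /negP/negbTE bi]].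
    by apply: nearW => n; rewrite big1// => i _; rewrite ball.
  by exists i.+1 => // n /= ni; rewrite (bigD1 (Ordinal ni))//= bi mul0r.
have prod_le1 (b : nat -> bool) n : `|\prod_(i < n) (b i)%:R : R| <= 1.
  by rewrite normr_prod prodr_ile1// => i _; rewrite normr_nat lern1 leq_b1 ler0n.
apply: (@multiplier_cvg (fun n x => \prod_(i < n) (`|u i x| <= s)%R%:R)
  (fun n y => \prod_(i < n) (`|v i y| <= s)%R%:R) _ _ 1).
- elim=> [|n IHn].
    under eq_fun do rewrite big_ord0.
    under [X in multiplier _ X]eq_fun do rewrite big_ord0.
    exact: multiplier_cst.
  under eq_fun do rewrite big_ord_recr.
  under [X in multiplier _ X]eq_fun do rewrite big_ord_recr.
  by apply: multiplierM => //; exact: multiplier_indic.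
- by move=> n x; exact: (prod_le1 (fun i => `|u i x| <= s)).
- by move=> n y; exact: (prod_le1 (fun i => `|v i y| <= s)).
- by move=> x; exact: (prod_cvg (fun i => `|u i x| <= s)).
- by move=> y; exact: (prod_cvg (fun i => `|v i y| <= s)).
Qed.

Lemma multiplier_Rintegral u v g h : L (u, v) -> multiplier g h ->
  \int[P1]_x g x = \int[P2]_y h y.
Proof.
move=> Luv [bg bh gh].
have L0 := L_lin 0 0 Luv Luv.
have agree1 : cos_agree (cst 1) (cst 1).
  move=> u' v' Luv'; have := L_cos Luv'.
  by under eq_Rintegral do rewrite -[cos _]mul1r;
    under [RHS]eq_Rintegral do rewrite -[cos _]mul1r.
have := gh _ _ (bounded_measurable_cst _ 1) (bounded_measurable_cst _ 1)
  agree1 _ _ L0.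
have E (a b c : R) : 1 * a * cos (0 * b + 0 * c) = a.
  by rewrite !mul0r addr0 cos0 mulr1 mul1r.
by under eq_Rintegral do rewrite E; under [X in _ = X]eq_Rintegral do rewrite E.
Qed.

End cosine_transform.

(** * One-dimensional Gaussian integrals *)

Section density.
Context d (T : measurableType d) (R : realType).
Context (mu : {sigma_finite_measure set T -> \bar R}).
Context (nu : {finite_measure set T -> \bar R}) (g : T -> \bar R).
Local Open Scope ereal_scope.

(** Two densities of [nu] with respect to [mu] agree almost everywhere, so the
    change of variables known for the Radon-Nikodym derivative holds for any
    given density. *)
Lemma ge0_integral_density (f : T -> \bar R) :
  mu.-integrable setT g -> (forall x, 0 <= g x) ->
  (forall A, measurable A -> nu A = \int[mu]_(x in A) g x) ->
  measurable_fun setT f -> (forall x, 0 <= f x) ->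
  \int[nu]_x f x = \int[mu]_x (f x * g x).
Proof.
move=> ig g0 nuE mf f0; have mg := measurable_int _ ig.
have numu : nu `<< mu.
  apply/null_content_dominatesP => A mA muA0; rewrite nuE//.
  by apply: null_set_integral => //; exact: measurable_funTS.
have iRN := Radon_Nikodym_SigmaFinite.f_integrable numu.
have mRN := measurable_int _ iRN.
rewrite -(Radon_Nikodym_SigmaFinite.change_of_variables numu f0 measurableT mf).
apply: ae_eq_integral => //; try exact: emeasurable_funM.
apply: ae_eqe_mul2l; apply: integral_ae_eq => // A _ mA.
by rewrite -Radon_Nikodym_SigmaFinite.f_integral// nuE.
Qed.

End density.

Section normal_integrals.
Context (R : realType).
Notation mu := (@lebesgue_measure R).

Lemma ge0_integral_affine (G : R -> R) (a b : R) : 0 < a -> continuous G ->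
  (forall x, 0 <= G x) ->
  (\int[mu]_x (G x)%:E = \int[mu]_x (a * G (a * x + b))%:E)%E.
Proof.
move=> a0 cG G0; pose F x := a * x + b.
have dF (x : R^o) : is_derive x (1 : R^o) (F : R^o -> R^o) a.
  rewrite (_ : F = a \*: (id : R^o -> R^o) \+ cst b)//.
  by apply: is_derive_eq; rewrite addr0 /GRing.scale /= mulr1.
have F'E : F^`()%classic = cst a.
  by apply/funext => x; rewrite derive1E derive_val.
rewrite (increasing_ge0_integration_by_substitutionT (F := F))//.
- by apply: eq_integral => x _; rewrite F'E /= mulrC.
- by move=> x y xy; rewrite /F ltrD2r ltr_pM2l.
- by rewrite F'E => x; exact: cvg_cst.
- by rewrite F'E; exact: is_cvg_cst.
- by rewrite F'E; exact: is_cvg_cst.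
- apply: (@cvg_comp _ _ _ ( *%R a) (+%R^~ b)); last exact: cvg_addrr_Ny.
  by apply: gt0_cvgMrNy => //; exact: cvg_id.
- apply: (@cvg_comp _ _ _ ( *%R a) (+%R^~ b)); last exact: cvg_addrr.
  by apply: gt0_cvgMry => //; exact: cvg_id.
Qed.

Lemma normal_peakE (s : R) : 0 < s ->
  normal_peak s = (s * Num.sqrt (pi *+ 2))^-1.
Proof.
by move=> s0; rewrite /normal_peak -mulrnAr sqrtrM ?sqr_ge0// sqrtr_sqr gtr0_norm.
Qed.

Lemma sqrt2pi_neq0 : Num.sqrt (pi *+ 2) != 0 :> R.
Proof. by rewrite sqrtr_eq0 -ltNge mulrn_wgt0// pi_gt0. Qed.

(** Completing the square. *)
Lemma expR_normal_pdf (m s t x : R) : s != 0 ->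
  expR (t * x) * normal_pdf m s x =
  expR (t * m + t ^+ 2 * s ^+ 2 / 2) * normal_pdf (m + t * s ^+ 2) s x.
Proof.
move=> s0; rewrite !normal_pdfE// mulrCA [RHS]mulrCA; congr (_ * _).
by rewrite /normal_fun -!expRD; congr expR; field.
Qed.

Lemma integral_expR_normal_pdf (m s t : R) : s != 0 ->
  (\int[mu]_x (expR (t * x) * normal_pdf m s x)%:E =
   (expR (t * m + t ^+ 2 * s ^+ 2 / 2))%:E)%E.
Proof.
move=> s0; under eq_integral do rewrite expR_normal_pdf// EFinM.
rewrite integralZl// ?integral_normal_pdf ?mule1//.
exact: integrable_normal_pdf.
Qed.

(** Completing the square in [x]: the product is the density of the sum at [z]
    times the conditional density of the first summand given the sum. *)
Lemma normal_pdf_convolution (a b c x z : R) : 0 < a -> 0 < b -> 0 < c ->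
  c ^+ 2 = a ^+ 2 + b ^+ 2 ->
  normal_pdf 0 a x * normal_pdf 0 b (z - x) =
  normal_pdf 0 c z * normal_pdf (z * a ^+ 2 / c ^+ 2) (a * b / c) x.
Proof.
move=> a0 b0 c0 cE; have abc0 : 0 < a * b / c by rewrite divr_gt0// mulr_gt0.
have [aN0 bN0 cN0] : [/\ a != 0, b != 0 & c != 0] by rewrite !gt_eqF.
rewrite !normal_pdfE ?gt_eqF// !normal_peakE// mulrACA [RHS]mulrACA.
have k0 := sqrt2pi_neq0; congr (_ * _).
  by field; rewrite k0 aN0 bN0 cN0.
rewrite /normal_fun -!expRD; congr expR.
have c20 : a ^+ 2 + b ^+ 2 != 0 by rewrite -cE expf_neq0.
rewrite exprMn exprVn exprMn cE; field.
by rewrite c20 aN0 bN0.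
Qed.

End normal_integrals.

Section gauss_mean.
Context (R : realType).
Notation mu := (@lebesgue_measure R).
Local Open Scope ereal_scope.
Implicit Types (m s : R) (h : R -> \bar R).

(** The integral of [h] against [gaussian_law m s]. *)
Definition gauss_mean m s h : \bar R :=
  if s == 0%R then h m else \int[mu]_x (h x * (normal_pdf m s x)%:E).

Lemma gauss_mean_expR m s (t : R) :
  gauss_mean m s (fun x => (expR (t * x))%:E) =
  (expR (t * m + t ^+ 2 * s ^+ 2 / 2))%:E.
Proof.
rewrite /gauss_mean; have [->|s0] := eqVneq s 0%R.
  by rewrite expr0n /= mulr0 mul0r addr0.
by under eq_integral do rewrite -EFinM; rewrite integral_expR_normal_pdf.
Qed.

Let second_moment := \int[mu]_x (x ^+ 2 * normal_pdf 0 1 x)%:E.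

Let meas_sqr_pdf m s : measurable_fun setT (fun x : R => (x ^+ 2 * normal_pdf m s x)%:E).
Proof.
by apply/measurable_EFinP/measurable_funM; [exact: measurable_funX|exact: measurable_normal_pdf].
Qed.

(** A square is dominated by exponentials, whose Gaussian integrals are
    explicit. *)
Lemma second_moment_lty : second_moment < +oo.
Proof.
have meas_exp (t : R) : measurable_fun setT
    (fun x : R => (expR (t * x) * normal_pdf 0 1 x)%:E).
  apply/measurable_EFinP; apply: measurable_funM; last exact: measurable_normal_pdf.
  by apply: measurableT_comp => //; exact: measurable_funM.
have ge0_exp (t x : R) : 0 <= (expR (t * x) * normal_pdf 0 1 x)%:E.
  by rewrite lee_fin mulr_ge0 ?expR_ge0 ?normal_pdf_ge0.
pose E := \int[mu]_x ((expR (2 * x) * normal_pdf 0 1 x)%:E +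
                      (expR (- 2 * x) * normal_pdf 0 1 x)%:E).
apply: (@le_lt_trans _ _ E); last first.
  have -> : E = \int[mu]_x (expR (2 * x) * normal_pdf 0 1 x)%:E +
                \int[mu]_x (expR (- 2 * x) * normal_pdf 0 1 x)%:E.
    by apply: ge0_integralD => //; exact: meas_exp.
  by rewrite !integral_expR_normal_pdf ?oner_eq0// ltry.
apply: ge0_le_integral => //.
- by move=> x _; rewrite lee_fin mulr_ge0 ?sqr_ge0 ?normal_pdf_ge0.
- exact: meas_sqr_pdf.
- by apply: emeasurable_funD; exact: meas_exp.
move=> x _; rewrite -EFinD lee_fin -mulrDl ler_wpM2r ?normal_pdf_ge0//.
have e1 := expR_ge1Dx x; have e2 := expR_ge1Dx (- x).
have p1 := expR_gt0 x; have p2 := expR_gt0 (- x).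
have -> : expR (2 * x) = (expR x ^+ 2)%R by rewrite -expRM_natl; congr expR; ring.
have -> : expR (- 2 * x) = (expR (- x) ^+ 2)%R.
  by rewrite -expRM_natl; congr expR; ring.
rewrite !expr2; have [x0|x0] := leP 0%R x; nra.
Qed.

Lemma second_moment_gt0 : 0 < second_moment.
Proof.
pose c := normal_pdf 0 1 (2 : R).
have c0 : (0 < c)%R.
  by rewrite /c normal_pdfE ?oner_eq0// mulr_gt0 ?expR_gt0// normal_peak_gt0// oner_eq0.
apply: (@lt_le_trans _ _ (\int[mu]_(x in `[1%R, 2%R]) (cst c%:E x))).
  rewrite integral_cst//= lebesgue_measure_itv/= lte_fin ltr1n -EFinD -EFinM lte_fin.
  by rewrite mulr_gt0// subr_gt0 ltr1n.
apply: (@le_trans _ _ (\int[mu]_(x in `[1%R, 2%R]) (x ^+ 2 * normal_pdf 0 1 x)%:E)).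
  apply: ge0_le_integral => //.
  - by move=> x _; rewrite lee_fin ltW.
  - by apply: measurable_funTS; exact: meas_sqr_pdf.
  move=> x /=; rewrite in_itv/= => /andP[x1 x2].
  rewrite lee_fin -[leLHS]mul1r ler_pM ?(ltW c0)//.
    by rewrite exprn_ege1.
  rewrite /c !normal_pdfE ?oner_eq0// ler_wpM2l ?normal_peak_ge0//.
  rewrite /normal_fun ler_expR !mulNr lerN2 ler_wpM2r ?invr_ge0 ?mulrn_wge0 ?sqr_ge0//.
  by rewrite !subr0 lerXn2r ?nnegrE//; lra.
apply: ge0_subset_integral => //; first exact: meas_sqr_pdf.
by move=> x _; rewrite lee_fin mulr_ge0 ?sqr_ge0 ?normal_pdf_ge0.
Qed.

(** Only the proportionality of the second moment to [s ^ 2] matters below, so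
    the constant, which is 1, is left undetermined. *)
Lemma gauss_mean_sqr : exists2 M : R, (0 < M)%R & forall s, (0 <= s)%R ->
  gauss_mean 0 s (fun x => (x ^+ 2)%:E) = (s ^+ 2 * M)%:E.
Proof.
have M_fin : second_moment \is a fin_num.
  by rewrite ge0_fin_numE ?second_moment_lty// ltW// second_moment_gt0.
exists (fine second_moment).
  by rewrite fine_gt0// second_moment_gt0 second_moment_lty.
move=> s s0; rewrite /gauss_mean; have [->|sN0] := eqVneq s 0%R.
  by rewrite expr0n mul0r.
have {}s0 : (0 < s)%R by rewrite lt_neqAle eq_sym sN0.
under eq_integral do rewrite -EFinM.
rewrite (ge0_integral_affine 0 s0); last 2 first.
- by move=> x; apply: cvgM; [exact: exprn_continuous|exact: continuous_normal_pdf].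
- by move=> x; rewrite mulr_ge0 ?sqr_ge0 ?normal_pdf_ge0.
rewrite EFinM fineK// -integralZl//; last first.
  apply/integrableP; split; first exact: meas_sqr_pdf.
  under eq_integral => x _.
    rewrite /= ger0_norm; last by rewrite mulr_ge0 ?sqr_ge0 ?normal_pdf_ge0.
    over.
  exact: second_moment_lty.
apply: eq_integral => x _; rewrite -EFinM; congr EFin.
rewrite addr0 !normal_pdfE ?oner_eq0// !normal_peakE//.
have -> : normal_fun 0 s (s * x) = normal_fun 0 1 x.
  by rewrite /normal_fun !subr0; congr expR; field.
by have k0 := sqrt2pi_neq0 R; field; rewrite k0.
Qed.

End gauss_mean.

Section gauss_convolution.
Context (R : realType).
Notation mu := (@lebesgue_measure R).
Local Open Scope ereal_scope.

(** The sum of independent centred Gaussian variables is Gaussian, in terms of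
    integrals; [a] or [b] may be 0, in which case the law is a point mass. *)
Lemma gauss_mean_convolution (a b c : R) (h : R -> R) :
  (0 <= a)%R -> (0 <= b)%R -> (0 <= c)%R ->
  (c ^+ 2 = a ^+ 2 + b ^+ 2)%R -> continuous h -> (forall x, 0 <= h x)%R ->
  gauss_mean 0 a (fun x => gauss_mean 0 b (fun y => (h (x + y)%R)%:E)) =
  gauss_mean 0 c (fun z => (h z)%:E).
Proof.
move=> a0 b0 c0 cE ch h0.
have sqrI (x y : R) : (0 <= x -> 0 <= y -> x ^+ 2 = y ^+ 2 -> x = y)%R.
  by move=> x0 y0 /eqP; rewrite eqrXn2// => /eqP.
have [a_eq0|aN0] := eqVneq a 0%R.
  have -> : c = b by apply: sqrI => //; rewrite cE a_eq0 expr0n add0r.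
  rewrite a_eq0 {1}/gauss_mean eqxx.
  by congr gauss_mean; apply/funext => y; rewrite add0r.
have [b_eq0|bN0] := eqVneq b 0%R.
  have -> : c = a by apply: sqrI => //; rewrite cE b_eq0 expr0n addr0.
  by congr gauss_mean; apply/funext => x; rewrite b_eq0 /gauss_mean eqxx addr0.
have {}a0 : (0 < a)%R by rewrite lt_neqAle eq_sym aN0.
have {}b0 : (0 < b)%R by rewrite lt_neqAle eq_sym bN0.
have {}c0 : (0 < c)%R.
  by rewrite lt_neqAle c0 andbT eq_sym -sqrf_eq0 cE gt_eqF// addr_gt0 ?exprn_gt0.
rewrite /gauss_mean (negbTE aN0) (negbTE bN0) gt_eqF//.
pose k (p : R * R) := (h p.2 * normal_pdf 0 b (p.2 - p.1) * normal_pdf 0 a p.1)%R.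
have mk : measurable_fun setT (fun p : R * R => (k p)%:E).
  apply/measurable_EFinP; apply: measurable_funM; last first.
    exact: (measurableT_comp (measurable_normal_pdf _ _) measurable_fst).
  apply: measurable_funM.
    apply: (measurableT_comp _ measurable_snd).
    exact: continuous_measurable_fun.
  apply: (measurableT_comp (measurable_normal_pdf _ _)).
  by apply: measurable_funB.
have k_ge0 p : 0 <= (k p)%:E by rewrite lee_fin !mulr_ge0 ?normal_pdf_ge0.
transitivity (\int[mu]_x \int[mu]_z (k (x, z))%:E).
  apply: eq_integral => x _.
  rewrite [X in X * _ = _](_ : _ =
      \int[mu]_z (h z * normal_pdf 0 b (z - x))%:E); last first.
    under eq_integral do rewrite -EFinM.
    rewrite (ge0_integral_affine (- x) (ltr01 : (0 < 1 :> R)%R)).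
    - by apply: eq_integral => z _; rewrite !mul1r addrC subrK.
    - move=> y; apply: cvgM; last exact: continuous_normal_pdf.
      apply: (@cvg_comp _ _ _ (+%R x) h); last exact: ch.
      by apply: cvgD; [exact: cvg_cst|exact: cvg_id].
    - by move=> y; rewrite mulr_ge0 ?normal_pdf_ge0.
  have m2 : measurable_fun setT (fun z : R => (h z * normal_pdf 0 b (z - x))%:E).
    apply/measurable_EFinP; apply: measurable_funM.
      exact: continuous_measurable_fun.
    by apply: (measurableT_comp (measurable_normal_pdf _ _)); exact: measurable_funB.
  rewrite -ge0_integralZr ?lee_fin ?normal_pdf_ge0//.
  by move=> z _; rewrite lee_fin mulr_ge0 ?normal_pdf_ge0.
transitivity (\int[mu]_z \int[mu]_x (k (x, z))%:E).
  exact: (@fubini_tonelli _ _ _ _ R mu mu (fun p => (k p)%:E) mk k_ge0).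
apply: eq_integral => z _.
under eq_integral => x _.
  rewrite /k/= -mulrA [(normal_pdf 0 b _ * _)%R]mulrC.
  rewrite (normal_pdf_convolution x z a0 b0 c0 cE) mulrA EFinM.
  over.
rewrite integralZl// ?integral_normal_pdf ?mule1//.
exact: integrable_normal_pdf.
Qed.

End gauss_convolution.

(** * Centred Gaussian variables and independent sums *)

Section gaussian_variables.
Context d (T : measurableType d) (R : realType) (P : probability T R).
Implicit Types Y : T -> R.

Lemma gaussian_integral Y (m s : R) (h : R -> \bar R) :
  measurable_fun setT Y ->
  (forall A, measurable A -> P (Y @^-1` A) = gaussian_law m s A) ->
  measurable_fun setT h -> (forall x, 0 <= h x)%E ->
  (\int[P]_w h (Y w) = gauss_mean m s h)%E.
Proof.
move=> mY lawY mh h0.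
have law_integral (nu : {measure set (measurableTypeR R) -> \bar R}) :
    (forall A, measurable A -> P (Y @^-1` A) = nu A) ->
    (\int[P]_w h (Y w) = \int[nu]_x h x)%E.
  move=> nuE.
  have := @ge0_integral_pushforward _ _ T (measurableTypeR R) R Y mY P setT h
    measurableT mh (fun y _ => h0 y).
  rewrite preimage_setT => <-.
  by apply: (@eq_measure_integral _ _ R setT nu _ h) => A mA _; exact: nuE.
rewrite /gauss_mean; case: ifPn => [/eqP s0|s0].
  rewrite (law_integral (@dirac _ (measurableTypeR R) m R)) ?integral_dirac ?diracT ?mul1e//.
  by move=> A mA; rewrite lawY// /gaussian_law s0 eqxx.
rewrite (law_integral (normal_prob m s)); last first.
  by move=> A mA; rewrite lawY// /gaussian_law (negbTE s0).
apply: ge0_integral_density => //; first exact: integrable_normal_pdf.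
by move=> x; rewrite lee_fin normal_pdf_ge0.
Qed.

Definition centred_normal Y (s : R) :=
  [/\ measurable_fun setT Y, 0 <= s &
      forall A, measurable A -> P (Y @^-1` A) = gaussian_law 0 s A].

(** Jensen's inequality: [E exp (t Y) >= 1 + t E Y = 1] for all real [t], whereas
    [E exp (t Y) = exp (t m + t ^ 2 s ^ 2 / 2)], which is less than 1 for a
    suitable small [t] unless [m = 0]. *)
Lemma zero_mean_centred_normal Y : gaussian_rv P Y -> ('E_P[Y] = 0)%E ->
  exists s, centred_normal Y s.
Proof.
move=> [mY [m [s [s0 lawY]]]]; rewrite unlock => EY.
have mexp (t : R) : measurable_fun setT (fun x : R => (expR (t * x))%:E).
  by apply/measurable_EFinP; apply: measurableT_comp.
have Eexp (t : R) : (\int[P]_w (expR (t * Y w))%:E =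
    (expR (t * m + t ^+ 2 * s ^+ 2 / 2))%:E)%E.
  by rewrite -gauss_mean_expR -(gaussian_integral mY lawY).
have iexp (t : R) : P.-integrable setT (EFin \o (fun w => expR (t * Y w))).
  apply/integrableP; split; first exact: measurableT_comp (mexp t) mY.
  under eq_integral => w _ do rewrite /= ger0_norm ?expR_ge0//.
  by rewrite Eexp ltry.
have iY : P.-integrable setT (EFin \o Y).
  have iD := integrableD measurableT (iexp 1) (iexp (-1)).
  apply: le_integrable iD => //; first exact/measurable_EFinP.
  move=> w _; rewrite /= lee_fin [leRHS]ger0_norm ?addr_ge0 ?expR_ge0//.
  have := expR_ge1Dx (1 * Y w); have := expR_ge1Dx (-1 * Y w).
  have := expR_gt0 (1 * Y w); have := expR_gt0 (-1 * Y w).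
  by rewrite ler_norml => ? ? ? ?; apply/andP; split; lra.
have EY0 : \int[P]_w Y w = 0 by rewrite /Rintegral EY.
have exponent_ge0 (t : R) : 0 <= t * m + t ^+ 2 * s ^+ 2 / 2.
  rewrite -ler_expR expR0.
  have -> : expR (t * m + t ^+ 2 * s ^+ 2 / 2) = \int[P]_w expR (t * Y w).
    by rewrite /Rintegral Eexp.
  have i1 : P.-integrable setT (EFin \o (cst 1 : T -> R)).
    exact: finite_measure_integrable_cst.
  have itY : P.-integrable setT (EFin \o (fun w => t * Y w)).
    by have := integrableZl measurableT t iY.
  have -> : 1 = \int[P]_w (1 + t * Y w) :> R.
    rewrite RintegralD// RintegralZl// EY0 mulr0 addr0.
    by rewrite Rintegral_cst// [X in fine X](probability_setT P) mulr1.
  apply: le_Rintegral => //; last by move=> w _; exact: expR_ge1Dx.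
  by have := integrableD measurableT i1 itY.
suff m0 : m = 0 by exists s; split=> // A mA; rewrite -m0 lawY.
have q0 : 0 < s ^+ 2 + 1 by rewrite ltr_wpDl// sqr_ge0.
have := exponent_ge0 (- m / (s ^+ 2 + 1)).
have -> : - m / (s ^+ 2 + 1) * m + (- m / (s ^+ 2 + 1)) ^+ 2 * s ^+ 2 / 2 =
    - (m ^+ 2 * ((s ^+ 2 + 2) / (2 * (s ^+ 2 + 1) ^+ 2))).
  by field; rewrite gt_eqF.
rewrite oppr_ge0 pmulr_lle0; last first.
  by rewrite divr_gt0 ?mulr_gt0 ?exprn_gt0// ltr_wpDl// sqr_ge0.
by move=> m2; apply/eqP; rewrite -sqrf_eq0 eq_le m2 sqr_ge0.
Qed.

Lemma centred_normal_sqr : exists2 M : R, 0 < M & forall Y s,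
  centred_normal Y s -> (\int[P]_w (Y w ^+ 2)%:E = (s ^+ 2 * M)%:E)%E.
Proof.
have [M M0 sqrE] := gauss_mean_sqr R.
exists M => // Y s [mY s0 lawY]; rewrite -sqrE// -(gaussian_integral mY lawY)//.
  by apply/measurable_EFinP; exact: measurable_funX.
by move=> x; rewrite lee_fin sqr_ge0.
Qed.

End gaussian_variables.

Section independent_sum.
Context d (T : measurableType d) (R : realType) (P : probability T R).

Lemma independent_sum_integral (Y Z : T -> R) (a b c : R) (h : R -> R) :
  centred_normal P Y a -> centred_normal P Z b ->
  0 <= c -> c ^+ 2 = a ^+ 2 + b ^+ 2 -> continuous h -> (forall x, 0 <= h x) ->
  (\int[P \x P]_p (h (Y p.1 + Z p.2))%:E = gauss_mean 0 c (fun z => (h z)%:E))%E.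
Proof.
move=> [mY a0 lawY] [mZ b0 lawZ] c0 cE ch h0.
have mh : measurable_fun setT (fun x => (h x)%:E).
  by apply/measurable_EFinP; exact: continuous_measurable_fun.
have mhD (x : R) : measurable_fun setT (fun y => (h (x + y))%:E).
  by apply: (measurableT_comp mh); exact: measurable_funD.
have hD0 (x y : R) : (0 <= (h (x + y))%:E)%E by rewrite lee_fin.
have inner (x : R) : (\int[P]_w (h (x + Z w))%:E =
    gauss_mean 0 b (fun y => (h (x + y))%:E))%E.
  exact: (gaussian_integral mZ lawZ (mhD x) (hD0 x)).
have mYZ : measurable_fun setT (fun p : T * T => (h (Y p.1 + Z p.2))%:E).
  apply: (measurableT_comp mh); apply: measurable_funD.
    exact: (measurableT_comp mY measurable_fst).
  exact: (measurableT_comp mZ measurable_snd).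
rewrite fubini_tonelli1//.
rewrite -(gauss_mean_convolution a0 b0 c0 cE ch h0).
rewrite -(gaussian_integral mY lawY).
- by apply: eq_integral => w _; rewrite -inner.
- under eq_fun do rewrite -inner.
  have mxZ : measurable_fun setT (fun p : R * T => (h (p.1 + Z p.2))%:E).
    apply: (measurableT_comp mh); apply: measurable_funD => //.
    exact: (measurableT_comp mZ measurable_snd).
  apply: (@measurable_fun_fubini_tonelli_F _ _ _ _ _ P _ mxZ) => p.
  by rewrite lee_fin.
- by move=> x; rewrite -inner; apply: integral_ge0 => w _; rewrite lee_fin.
Qed.

(** The right-hand side depends only on the total variance [c ^ 2]; the constant
    1 is added so that the integrand is nonnegative. *)
Lemma independent_sum_cos (Y Z : T -> R) (a b c : R) :
  centred_normal P Y a -> centred_normal P Z b ->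
  0 <= c -> c ^+ 2 = a ^+ 2 + b ^+ 2 ->
  \int[(P \x P)%E]_p cos (Y p.1 + Z p.2) =
  fine (gauss_mean 0 c (fun z => (1 + cos z)%:E)) - 1.
Proof.
move=> NY NZ c0 cE; have [[mY _ _] [mZ _ _]] := (NY, NZ).
have mYZ : measurable_fun setT (fun p : T * T => Y p.1 + Z p.2).
  apply: measurable_funD; first exact: (measurableT_comp mY measurable_fst).
  exact: (measurableT_comp mZ measurable_snd).
rewrite -(independent_sum_integral NY NZ c0 cE); last 2 first.
- by move=> x; apply: cvgD; [exact: cvg_cst|exact: continuous_cos].
- by move=> x; rewrite addrC -[1]opprK subr_ge0 cos_geN1.
have -> : fine (\int[P \x P]_p (1 + cos (Y p.1 + Z p.2))%:E)%E =
    \int[(P \x P)%E]_p (1 + cos (Y p.1 + Z p.2)) by [].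
rewrite RintegralD//; last 2 first.
- exact: (bounded_measurable_integrable _ (bounded_measurable_cst _ 1)).
- exact: (bounded_measurable_integrable _ (bounded_measurable_cos mYZ)).
rewrite Rintegral_cst// [X in fine X](probability_setT (P \x P)%E) mulr1.
by rewrite addrAC subrr add0r.
Qed.

End independent_sum.

(** * From a self-improving tail bound to an exponential moment *)

Section indicators.
Context d (T : measurableType d) (R : realType) (P : probability T R).

Lemma Rintegral_bool (b : T -> bool) : measurable [set x | b x] ->
  \int[P]_x (b x)%:R = fine (P [set x | b x]).
Proof.
move=> mb; rewrite /Rintegral -[X in fine (P X)]setIT -integral_indic//.
by congr fine; apply: eq_integral => x _; rewrite indicE mem_setE.
Qed.

Lemma measurable_sublevel (N : T -> R) (s : R) : measurable_fun setT N ->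
  measurable [set w | N w <= s].
Proof.
move=> mN; have := mN measurableT _ (measurable_itv `]-oo, s]).
rewrite setTI; congr (measurable _); apply/seteqP; split=> w /=;
  by rewrite in_itv.
Qed.

Lemma measurable_superlevel (N : T -> R) (s : R) : measurable_fun setT N ->
  measurable [set w | s < N w].
Proof.
move=> mN; have := mN measurableT _ (measurable_itv `]s, +oo[).
rewrite setTI; congr (measurable _); apply/seteqP; split=> w /=;
  by rewrite in_itv /= andbT.
Qed.

End indicators.

Section fernique_tail.
Context d (T : measurableType d) (R : realType) (P : probability T R).
Context (N : T -> R).
Hypothesis mN : measurable_fun setT N.
Hypothesis N0 : forall w, 0 <= N w.

Let r2 : R := Num.sqrt 2.

Definition tail (t : R) : R := fine (P [set w | t < N w]).

Hypothesis tail_contract : forall s t,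
  fine (P [set w | N w <= s]) * tail t <= tail ((t - s) / r2) ^+ 2.

Let r2_sqr : r2 ^+ 2 = 2. Proof. by rewrite sqr_sqrtr. Qed.
Let r2_gt0 : 0 < r2. Proof. by rewrite sqrtr_gt0. Qed.
Let r2_ge : 4 / 3 <= r2.
Proof. by rewrite -(@ler_pXn2r _ 2) ?nnegrE// ?ltW// r2_sqr; lra. Qed.

Lemma tail_ge0 t : 0 <= tail t. Proof. exact: fine_ge0. Qed.

Lemma tail_le s t : s <= t -> tail t <= tail s.
Proof.
move=> st; apply: fine_le.
- exact/fin_num_measure/measurable_superlevel.
- exact/fin_num_measure/measurable_superlevel.
apply: le_measure; rewrite ?inE; [exact: measurable_superlevel|exact: measurable_superlevel|].
by move=> w /=; exact: le_lt_trans.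
Qed.

Lemma tail_cvg0 : tail n%:R @[n --> \oo] --> 0.
Proof.
have -> : (fun n => tail n%:R) = fun n => \int[P]_w (n%:R < N w)%R%:R.
  by apply/funext => n; rewrite Rintegral_bool//; exact: measurable_superlevel.
have -> : 0 = \int[P]_w (0 : R) by rewrite Rintegral_cst// mul0r.
apply: (@bounded_Rintegral_cvg _ _ _ _ _ _ 1).
- move=> n; split; last by exists 1 => w; rewrite normr_nat lern1 leq_b1.
  have := measurable_indic (measurable_superlevel n%:R mN) (D := setT) (R := R).
  congr measurable_fun; apply/funext => w.
  by rewrite indicE mem_setE.
- by move=> n w; rewrite normr_nat lern1 leq_b1.
move=> w; apply: cvg_near_cst; exists (Num.trunc (N w)).+1 => // n /= nN.
have /andP[_ Nt] := truncn_itv (N0 w).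
by rewrite ltNge (le_trans (ltW Nt))// ler_nat.
Qed.

(** The levels satisfy [t (n+1) - s >= sqrt 2 * t n], so that [tail (t n)]
    divided by [P (N <= s)] is at least squared from one level to the next; it
    starts at most at [(1/4) / (3/4)]. *)
Lemma tail_level_le s : 1 <= s -> tail s <= 4^-1 ->
  forall n, tail (s * (4 * r2 ^+ n - 3)) <= 3^-1 ^+ (2 ^ n).
Proof.
move=> s1 ts; set t := fun n => s * (4 * r2 ^+ n - 3).
pose q := fine (P [set w | N w <= s]).
have qE : q = 1 - tail s.
  rewrite /q; have -> : [set w | N w <= s] = ~` [set w | s < N w].
    by apply/seteqP; split=> w /=; rewrite leNgt => /negP.
  rewrite probability_setC; last exact: measurable_superlevel.
  by rewrite fineB//; exact/fin_num_measure/measurable_superlevel.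
have q34 : 3 / 4 <= q by rewrite qE; lra.
have q0 : 0 < q by lra.
have q1 : q <= 1 by rewrite qE gerBl tail_ge0.
suff H n : tail (t n) / q <= 3^-1 ^+ (2 ^ n).
  move=> n; apply: le_trans (H n); rewrite ler_pdivlMr// ler_piMr//.
  exact: tail_ge0.
elim: n => [|n IHn].
  rewrite expn0 expr1 /t expr0 (_ : s * _ = s); last by ring.
  by rewrite ler_pdivrMr//; lra.
have step : q * tail (t n.+1) <= tail (t n) ^+ 2.
  apply: le_trans (tail_contract s (t n.+1)) _.
  rewrite lerXn2r ?nnegrE ?tail_ge0//; apply: tail_le.
  rewrite ler_pdivlMr// /t exprS.
  have r2g : 4 / 3 <= r2 := r2_ge.
  have : 0 <= s * (3 * r2 - 4) by apply: mulr_ge0; lra.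
  lra.
rewrite expnSr exprM.
apply: (@le_trans _ _ ((tail (t n) / q) ^+ 2)); last first.
  by rewrite lerXn2r ?nnegrE ?exprn_ge0 ?divr_ge0 ?tail_ge0 ?(ltW q0).
rewrite expr_div_n ler_pdivrMr// expr2 invfM mulrA -[leRHS]mulrAC.
rewrite -[_ * q^-1 * q]mulrA mulVf ?gt_eqF// mulr1 ler_pdivlMr//.
by rewrite mulrC.
Qed.

(** On the shell [t n < N <= t (n+1)] the integrand is at most
    [exp (alpha * t (n+1) ^ 2)], and [t (n+1) ^ 2] grows like [2 ^ n]. *)
Lemma exp_sqr_integrable : exists alpha K : R, [/\ 0 < alpha, 0 < K &
  (\int[P]_w (expR (alpha * N w ^+ 2))%:E <= K%:E)%E].
Proof.
have [s [s1 ts]] : exists s, 1 <= s /\ tail s <= 4^-1.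
  have /cvgrPdist_le/(_ 4^-1) := tail_cvg0.
  rewrite invr_gt0 ltr0n => /(_ isT) [n _ /(_ n.+1 (leqnSn n))/=].
  rewrite sub0r normrN ger0_norm ?tail_ge0// => tn.
  by exists n.+1%:R; rewrite ler1n.
have tail_t := tail_level_le s1 ts.
set t := (fun n => s * (4 * r2 ^+ n - 3)) in tail_t.
have s0 : 0 < s by lra.
have r2n n : 1 <= r2 ^+ n by apply: exprn_ege1; have := r2_ge; lra.
have t_ge0 n : 0 <= t n by rewrite /t mulr_ge0 ?(ltW s0)//; have := r2n n; lra.
have t_sqr n : t n.+1 ^+ 2 <= 32 * s ^+ 2 * 2 ^+ n.
  have -> : 32 * s ^+ 2 * 2 ^+ n = (s * (4 * r2 ^+ n.+1)) ^+ 2.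
    by rewrite !exprMn -exprM mulnC exprM r2_sqr [2 ^+ n.+1]exprS; ring.
  rewrite lerXn2r ?nnegrE//.
    by rewrite mulr_ge0 ?(ltW s0)//; have := r2n n.+1; lra.
  by rewrite /t ler_wpM2l ?(ltW s0)// gerBl.
(* With this rate the weight on the n-th shell is at most (3/2)^(2^n), which
   the bound 3^-(2^n) on its probability beats by 2^-(2^n). *)
pose alpha : R := ln (3 / 2) / (32 * s ^+ 2).
have a0 : 0 < alpha.
  by rewrite divr_gt0 ?ln_gt0 ?mulr_gt0 ?exprn_gt0//; lra.
pose f n w : \bar R := (expR (alpha * t n.+1 ^+ 2) * (t n < N w)%R%:R)%:E.
have f0 n w : (0 <= f n w)%E by rewrite lee_fin mulr_ge0 ?expR_ge0.
have mf n : measurable_fun setT (f n).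
  apply/measurable_EFinP; apply: measurable_funM => //.
  have := measurable_indic (measurable_superlevel (t n) mN) (D := setT) (R := R).
  by congr measurable_fun; apply/funext => w; rewrite indicE mem_setE.
have Ef n : (\int[P]_w f n w <= (1 / (2 ^ n.+1)%:R)%:E)%E.
  have -> : (\int[P]_w f n w = (expR (alpha * t n.+1 ^+ 2) * tail (t n))%:E)%E.
    have mt := measurable_superlevel (t n) mN.
    have indE w : (t n < N w)%R%:R = \1_[set w | t n < N w] w :> R.
      by rewrite indicE mem_setE.
    under eq_integral => w _ do rewrite /f EFinM indE.
    rewrite ge0_integralZl ?lee_fin ?expR_ge0//; last first.
      exact/measurable_EFinP/measurable_indic.
    by rewrite integral_indic// setIT EFinM fineK//; exact: fin_num_measure.
  rewrite lee_fin; apply: (@le_trans _ _ ((3 / 2) ^+ (2 ^ n) * 3^-1 ^+ (2 ^ n))).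
    apply: ler_pM; rewrite ?expR_ge0 ?tail_ge0//; last exact: tail_t.
    rewrite -[X in _ <= X ^+ _]lnK ?posrE ?divr_gt0// -expRM_natl ler_expR.
    rewrite -[ln _](@divfK _ (32 * s ^+ 2)) ?gt_eqF ?mulr_gt0 ?exprn_gt0//.
    rewrite -/alpha [leRHS]mulrCA ler_pM2l// natrX [leRHS]mulrC; exact: t_sqr.
  rewrite -exprMn (_ : 3 / 2 * 3^-1 = 2^-1 :> R); last by field.
  rewrite exprVn div1r natrX lef_pV2 ?posrE ?exprn_gt0//.
  by rewrite ler_eXn2l// ?ltr1n// ltn_expl.
exists alpha, (expR (alpha * s ^+ 2) + 1); split=> //.
apply: (@le_trans _ _
    (\int[P]_w ((expR (alpha * s ^+ 2))%:E + \sum_(n <oo) f n w)))%E; last first.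
  rewrite ge0_integralD//.
  - rewrite integral_cst//= probability_setT mule1 EFinD leeD2l//.
    rewrite integral_nneseries//; apply: le_trans (epsilon_trick0 xpredT ler01).
    by apply: lee_nneseries => [n _ _|n _]; [exact: integral_ge0|exact: Ef].
  - by move=> w _; apply: nneseries_ge0.
  - by apply: ge0_emeasurable_sum.
apply: ge0_le_integral => //.
- apply/measurable_EFinP; apply: measurableT_comp => //.
  by apply: measurable_funM => //; exact: measurable_funX.
- by apply: emeasurable_funD => //; exact: ge0_emeasurable_sum.
move=> w _; have [Ns|sN] := leP (N w) s.
  rewrite -[leLHS]adde0; apply: leeD; last exact: nneseries_ge0.
  by rewrite lee_fin ler_expR ler_pM2l// lerXn2r ?nnegrE// (ltW s0).
have [n tn nt] : exists2 n, t n < N w & N w <= t n.+1.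
  have ex_t : exists n, N w <= t n.
    pose m := (Num.trunc (N w)).+1; exists m.*2.
    have /andP[_ /ltW Nm] := truncn_itv (N0 w); apply: le_trans Nm _.
    rewrite /t -mul2n exprM r2_sqr.
    have m2 : m%:R <= 2 ^+ m :> R by rewrite -natrX ler_nat ltnW// ltn_expl.
    have m1 : 1 <= 2 ^+ m :> R by apply: exprn_ege1; lra.
    have : 0 <= (s - 1) * (4 * 2 ^+ m - 3) by apply: mulr_ge0; lra.
    by rewrite -/m; lra.
  case: (ex_minnP ex_t) => -[|n] nt n_min.
    by move: nt; rewrite /t expr0 leNgt (_ : s * _ = s) ?sN//; ring.
  exists n => //; rewrite ltNge; apply/negP => /n_min.
  by rewrite ltnn.
rewrite -[leLHS]add0e; apply: leeD; first by rewrite lee_fin expR_ge0.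
apply: le_trans (nneseries_lim_ge n.+1 (fun i _ _ => f0 i w)).
rewrite big_mkord big_ord_recr /=; apply: (@le_trans _ _ (f n w)).
  rewrite /f tn mulr1 lee_fin ler_expR ler_pM2l//.
  by rewrite lerXn2r ?nnegrE.
by rewrite leeDr// sume_ge0.
Qed.

End fernique_tail.

(** * Rotation invariance *)

(** In the complex case this is the joint Gaussianity of the real and imaginary
    parts at the coefficients 1 and 0. *)
Lemma real_functional_normal (R : realType) (k : scalars)
    (B : normedModType (scalar_field R k)) d (T : measurableType d)
    (P : probability T R) (X : T -> B) (g : B -> R) :
  gaussian_field P X -> centred P X -> real_functional g ->
  exists s, centred_normal P (g \o X) s.
Proof.
move=> [_ GX] cX [f cf gE]; apply: zero_mean_centred_normal.
- have := GX f cf; case: k B X g GX cX f cf gE => B X g GX cX f cf gE /=.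
    by congr gaussian_rv; apply/funext => w /=; rewrite gE.
  move=> /(_ 1 0); congr gaussian_rv; apply/funext => w /=.
  by rewrite gE mul1r mul0r addr0.
- have := cX f cf; case: k B X g GX cX f cf gE => B X g GX cX f cf gE /=.
    by move=> <-; congr ('E_P[_])%E; apply/funext => w /=; rewrite gE.
  by move=> [<- _]; congr ('E_P[_])%E; apply/funext => w /=; rewrite gE.
Qed.

Section rotation.
Context (R : realType) (k : scalars) (B : normedModType (scalar_field R k)).
Context d (T : measurableType d) (P : probability T R) (X : T -> B).
Hypothesis GX : gaussian_field P X.
Hypothesis cX : centred P X.

Let Q := (P \x P)%E.
Let r : R := (Num.sqrt 2)^-1.

Let r_sqr : r ^+ 2 = 2^-1. Proof. by rewrite exprVn sqr_sqrtr. Qed.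

(** A linear form of the pair [(X p.1, X p.2)], matched with the same form of
    the pair rotated by an eighth of a turn. *)
Definition rotated_functionals : set ((T * T -> R) * (T * T -> R)) :=
  [set uv | exists f g : B -> R, [/\ real_functional f, real_functional g,
    uv.1 = (fun p => f (X p.1) + g (X p.2)) &
    uv.2 = (fun p => r * (f (X p.1) - f (X p.2)) + r * (g (X p.1) + g (X p.2)))]].

Lemma rotated_functionals_lin u v u' v' (a b : R) :
  rotated_functionals (u, v) -> rotated_functionals (u', v') ->
  rotated_functionals (fun x => a * u x + b * u' x, fun y => a * v y + b * v' y).
Proof.
move=> [f [g [rf rg /= -> ->]]] [f' [g' [rf' rg' /= -> ->]]].
exists (fun x => a * f x + b * f' x), (fun x => a * g x + b * g' x).
split; try exact: real_functional_lin; apply/funext => p /=; ring.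
Qed.

Lemma rotated_functionals_meas u v : rotated_functionals (u, v) ->
  measurable_fun setT u /\ measurable_fun setT v.
Proof.
move=> [f [g [rf rg /= -> ->]]].
have [_ [mf _ _]] := real_functional_normal GX cX rf.
have [_ [mg _ _]] := real_functional_normal GX cX rg.
have m1 (h : B -> R) : measurable_fun setT (h \o X) ->
    measurable_fun setT (fun p : T * T => h (X p.1)).
  by move=> mh; exact: (measurableT_comp mh measurable_fst).
have m2 (h : B -> R) : measurable_fun setT (h \o X) ->
    measurable_fun setT (fun p : T * T => h (X p.2)).
  by move=> mh; exact: (measurableT_comp mh measurable_snd).
split; first by apply: measurable_funD; [exact: m1|exact: m2].
by apply: measurable_funD; apply: measurable_funM => //;
  [apply: measurable_funB|apply: measurable_funD]; first [exact: m1|exact: m2].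
Qed.

(** With [F] and [G] as below, [F ^ 2 + G ^ 2 = f ^ 2 + g ^ 2] pointwise, so the
    two sides have the same total variance. *)
Lemma rotated_functionals_cos u v : rotated_functionals (u, v) ->
  \int[Q]_p cos (u p) = \int[Q]_p cos (v p).
Proof.
move=> [f [g [rf rg /= -> ->]]].
pose F x := r * f x + r * g x; pose G x := - r * f x + r * g x.
have rF : real_functional F by exact: real_functional_lin.
have rG : real_functional G by exact: real_functional_lin.
have [a Na] := real_functional_normal GX cX rf.
have [b Nb] := real_functional_normal GX cX rg.
have [a' Na'] := real_functional_normal GX cX rF.
have [b' Nb'] := real_functional_normal GX cX rG.
have [M M0 sqrE] := centred_normal_sqr P.
have par : a ^+ 2 + b ^+ 2 = a' ^+ 2 + b' ^+ 2.
  have sqrD (Y Z : T -> R) s t : centred_normal P Y s -> centred_normal P Z t ->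
      (\int[P]_w (Y w ^+ 2 + Z w ^+ 2)%:E = ((s ^+ 2 + t ^+ 2) * M)%:E)%E.
    move=> NY NZ; under eq_integral do rewrite EFinD.
    have [[mY _ _] [mZ _ _]] := (NY, NZ).
    rewrite ge0_integralD//; last 4 first.
    - by move=> w _; rewrite lee_fin sqr_ge0.
    - by apply/measurable_EFinP; exact: measurable_funX.
    - by move=> w _; rewrite lee_fin sqr_ge0.
    - by apply/measurable_EFinP; exact: measurable_funX.
    by rewrite (sqrE _ _ NY) (sqrE _ _ NZ) -EFinD mulrDl.
  have := sqrD _ _ _ _ Na' Nb'.
  under eq_integral => w _.
    have -> : (F \o X) w ^+ 2 + (G \o X) w ^+ 2 =
        (f \o X) w ^+ 2 + (g \o X) w ^+ 2.
      rewrite /F /G /=; transitivity (r ^+ 2 * (2 * f (X w) ^+ 2 + 2 * g (X w) ^+ 2)).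
        by ring.
      by rewrite r_sqr; field.
    over.
  rewrite (sqrD _ _ _ _ Na Nb) => -[].
  by apply: mulIf; rewrite gt_eqF.
have c2 : Num.sqrt (a ^+ 2 + b ^+ 2) ^+ 2 = a ^+ 2 + b ^+ 2.
  by rewrite sqr_sqrtr// addr_ge0 ?sqr_ge0.
rewrite (independent_sum_cos Na Nb (sqrtr_ge0 _) c2).
rewrite par in c2.
rewrite par -(independent_sum_cos Na' Nb' (sqrtr_ge0 _) c2).
by apply: eq_Rintegral => p _; congr cos; rewrite /F /G /=; ring.
Qed.

Hypothesis sepB : separable B.

Let N w := rnorm (X w).

Lemma measurable_rnorm : measurable_fun setT N.
Proof.
have [g [rg gP]] := norming_sequence sepB.
move=> mT; apply: (measurability _ (RGenOInfty.measurableE R)) => //.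
move=> _ [_ [s ->] <-]; rewrite setTI.
have -> : N @^-1` `]s, +oo[ = ~` \bigcap_i [set w | `|g i (X w)| <= s].
  apply/seteqP; split=> w /=; rewrite in_itv /= andbT.
    by move=> sN gs; move: sN; rewrite ltNge => /negP; apply; apply/gP => i; exact: gs.
  by move=> ngs; rewrite ltNge; apply/negP => /gP Ns; apply: ngs => i _; exact: Ns.
apply: measurableC; apply: bigcapT_measurable => i.
have [_ [mg _ _]] := real_functional_normal GX cX (rg i).
have mng : measurable_fun setT (fun w => `|(g i \o X) w|).
  exact: measurableT_comp mg.
exact: (measurable_sublevel s mng).
Qed.

Let mult := @multiplier _ (T * T)%type _ (T * T)%type R Q Q rotated_functionals.

Let scaled_le (s y : R) : (`|r * y| <= s) = (`|y| <= Num.sqrt 2 * s).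
Proof.
by rewrite normrM ger0_norm ?invr_ge0 ?sqrtr_ge0// mulrC ler_pdivrMr ?sqrtr_gt0// mulrC.
Qed.

Let multiplier_rnorm (s : R) (Y Z : T * T -> B) :
  (forall g, real_functional g ->
    rotated_functionals (fun p => g (Y p), fun p => r * g (Z p))) ->
  mult (fun p => (rnorm (Y p) <= s)%R%:R)
       (fun p => (rnorm (Z p) <= Num.sqrt 2 * s)%R%:R).
Proof.
have [g [rg gP]] := norming_sequence sepB.
move=> YZ; have gYZ i := YZ _ (rg i).
have := multiplier_indic_all Q Q rotated_functionals_meas
  rotated_functionals_lin s gYZ.
congr (multiplier _ _ _ _ _); apply/funext => p; congr ((nat_of_bool _)%:R).
  by apply/asboolP/idP => /gP.
apply/asboolP/idP => [H|/gP H i]; last by rewrite scaled_le.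
by apply/gP => i; rewrite -scaled_le.
Qed.

Lemma multiplier_fst s : mult (fun p => (N p.1 <= s)%R%:R)
  (fun p => (rnorm (X p.1 - X p.2) <= Num.sqrt 2 * s)%R%:R).
Proof.
apply: multiplier_rnorm => g rg.
have gB p : g (X p.1 - X p.2) = g (X p.1) - g (X p.2).
  rewrite -[X in _ = g X - _](subrK (X p.2)).
  by rewrite (real_functionalD (X p.1 - X p.2) (X p.2) rg) addrK.
exists g, (fun x => 0 * g x + 0 * g x); split=> //=.
- exact: real_functional_lin.
- by apply/funext => p; ring.
- by apply/funext => p; rewrite gB; ring.
Qed.

Lemma multiplier_snd s : mult (fun p => (N p.2 <= s)%R%:R)
  (fun p => (rnorm (X p.1 + X p.2) <= Num.sqrt 2 * s)%R%:R).
Proof.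
apply: multiplier_rnorm => g rg.
exists (fun x => 0 * g x + 0 * g x), g; split=> //=.
- exact: real_functional_lin.
- by apply/funext => p; ring.
- by apply/funext => p; rewrite (real_functionalD _ _ rg); ring.
Qed.

(** The left-hand side is the probability that [N p.1 <= s] and [N p.2 > t],
    which the rotation turns into an event implying that both norms exceed
    [(t - s) / sqrt 2]. *)
Lemma rnorm_tail_contract s t :
  fine (P [set w | N w <= s]) * tail P N t <= tail P N ((t - s) / Num.sqrt 2) ^+ 2.
Proof.
have mN := measurable_rnorm; set a := (t - s) / Num.sqrt 2.
have indB (b1 b2 : bool) : b1%:R * (1 + (-1) * b2%:R) = (b1 && ~~ b2)%:R :> R.
  by case: b1; case: b2 => /=; ring.
have Lg g : real_functional g ->
    rotated_functionals (fun p => g (X p.1), fun p => r * (g (X p.1) - g (X p.2))).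
  move=> rg; exists g, (fun x => 0 * g x + 0 * g x); split=> //=.
  - exact: real_functional_lin.
  - by apply/funext => p; ring.
  - by apply/funext => p; ring.
have [g [rg _]] := norming_sequence sepB.
have prodE (A1 A2 : set T) : measurable A1 -> measurable A2 ->
    fine (Q (A1 `*` A2)) = fine (P A1) * fine (P A2).
  by move=> mA1 mA2; rewrite /Q product_measure1E// fineM//; exact: fin_num_measure.
have mult_diff : mult
    (fun p => (N p.1 <= s)%R%:R * (1 + (-1) * (N p.2 <= t)%R%:R))
    (fun p => (rnorm (X p.1 - X p.2) <= Num.sqrt 2 * s)%R%:R *
      (1 + (-1) * (rnorm (X p.1 + X p.2) <= Num.sqrt 2 * t)%R%:R)).
  apply: multiplierM; first exact: multiplier_fst.
  apply: multiplierD; first exact: rotated_functionals_meas.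
    by apply: multiplier_cst; exact: rotated_functionals_meas.
  apply: multiplierM; last exact: multiplier_snd.
  by apply: multiplier_cst; exact: rotated_functionals_meas.
have := multiplier_Rintegral rotated_functionals_lin rotated_functionals_cos
  (Lg _ (rg 0%N)) mult_diff.
have {mult_diff} [_ bh _] := mult_diff.
under eq_Rintegral do rewrite indB.
rewrite Rintegral_bool; last first.
  rewrite (_ : [set p | _] = [set w | N w <= s] `*` [set w | t < N w]).
    by apply: measurableX; [exact: measurable_sublevel|exact: measurable_superlevel].
  by apply/seteqP; split=> p /=; rewrite ltNge => /andP.
rewrite (_ : [set p | _] = [set w | N w <= s] `*` [set w | t < N w]); last first.
  by apply/seteqP; split=> p /=; rewrite ltNge => /andP.
rewrite prodE; [|exact: measurable_sublevel|exact: measurable_superlevel].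
rewrite -/(tail P N t) => ->.
have mAA : measurable ([set w | a < N w] `*` [set w | a < N w]).
  by apply: measurableX; exact: measurable_superlevel.
have AAE : [set w | a < N w] `*` [set w | a < N w] =
    [set p | (a < N p.1) && (a < N p.2)].
  by apply/seteqP; split=> p /= /andP.
rewrite expr2 /tail -prodE; [|exact: measurable_superlevel|exact: measurable_superlevel].
rewrite AAE in mAA *; rewrite -Rintegral_bool//.
apply: le_Rintegral => //.
- exact: bounded_measurable_integrable bh.
- apply: bounded_measurable_integrable; split.
    have := measurable_indic mAA (D := setT) (R := R).
    by congr measurable_fun; apply/funext => p; rewrite indicE mem_setE.
  by exists 1 => p; rewrite normr_nat lern1 leq_b1.
move=> p _; rewrite indB.
case: (boolP (_ && ~~ _)) => [/andP[diff_le]|_]; last by rewrite ler0n.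
rewrite -ltNge => lt_sum.
have half (u v : B) : rnorm (u - v) <= Num.sqrt 2 * s ->
    Num.sqrt 2 * t < rnorm (u + v) -> a < rnorm u.
  move=> uv_le lt_uv.
  have r2 : 0 < Num.sqrt 2 :> R by rewrite sqrtr_gt0.
  have sum_le : rnorm (u + v) <= rnorm u + rnorm u + rnorm (u - v).
    rewrite -[v in rnorm (u + v)](subrK u) [v - u + u]addrC addrA (rnormB u).
    by apply: le_trans (rnormD _ _) _; rewrite lerD2r rnormD.
  have uuE : rnorm u + rnorm u = Num.sqrt 2 * (Num.sqrt 2 * rnorm u).
    by rewrite mulrA -expr2 sqr_sqrtr//; ring.
  rewrite /a ltr_pdivrMr// [_ * Num.sqrt 2]mulrC -(ltr_pM2l r2) -uuE mulrBr.
  lra.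
rewrite (half _ _ diff_le lt_sum) (half (X p.2) (X p.1))//.
  by rewrite rnormB.
by rewrite addrC.
Qed.

End rotation.

Theorem theorem2p5 (R : realType) (k : scalars)
    (B : completeNormedModType (scalar_field R k))
    (d : measure_display) (T : measurableType d) (P : probability T R)
    (X : T -> B) :
  separable B -> gaussian_field P X -> centred P X ->
  exists alpha K : R, [/\ 0 < alpha, 0 < K &
    ('E_P[fun w => expR (alpha * rnorm (X w) ^+ 2)] <= K%:E)%E].
Proof.
move=> sepB GX cX; rewrite unlock.
apply: exp_sqr_integrable.
- exact: measurable_rnorm GX cX sepB.
- by move=> w; exact: rnorm_ge0.
- exact: rnorm_tail_contract GX cX sepB.
Qed.
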